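(* Let $(X,d)$ be a compact metric space and let $f:X\to X$ be a positively expansive continuous map with the specification property. Then $$h_{top}(f)=\mathcal{E}(f_{\mathcal{M}},\mathcal{M}_f^{per}(X)).$$
   Context: $h_{top}(f)$ is topological entropy; $d_n(x,y)=\max_{0\le i\le n-1} d(f^ix,f^iy)$. $\mathcal M(X)$ is the set of Borel probability measures on $X$, $f_{\mathcal M}\mu=\mu\circ f^{-1}$. $\mathcal M_f^{per}(X)$ is the set of ergodic $f$-invariant probability measures supported on the orbit of a periodic point. $W_1^n(\mu,\nu)=\inf_{\pi}\int d_n\,d\pi$, infimum over Borel probability measures $\pi$ on $X\times X$ with marginals $\mu,\nu$. For nonempty $\mathcal Z\subset\mathcal M(X)$, $N_{\mathcal M}(\mathcal Z,n,\varepsilon)$ is the smallest cardinality of $E\subset\mathcal M(X)$ with every $\mu\in\mathcal Z$ within $W_1^n$-distance $\le\varepsilon$ of some element of $E$, and $\mathcal E(f_{\mathcal M},\mathcal Z)=\lim_{\varepsilon\to0}\limsup_{n\to\infty}\frac{\log\log N_{\mathcal M}(\mathcal Z,n,\varepsilon)}{n}$ (convention $\log0=0$). $f$ is positively expansive if there is $\rho>0$ such that for distinct $x,y$ there is $n\ge0$ with $d(f^nx,f^ny)>\rho$. $f$ has the specification property if for every $\varepsilon>0$ there is $n_0\in\mathbb N$ such that for any $x_1,\dots,x_k\in X$ and nonnegative integers $n_1,\dots,n_k$, $s_1,\dots,s_k$ with $s_i\ge n_0$, writing $m_j=\sum_{i=1}^j(n_i+s_i)$, $m_0=0$, there is $p\in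 X$ with $d(f^{m_{j-1}+i}p,f^ix_j)<\varepsilon$ for $0\le i<n_j$, $1\le j\le k$. *)

(* Defs.v *)
From Stdlib Require List.
From HB Require Import structures.
From mathcomp Require Import all_boot all_order all_algebra.
From mathcomp Require Import all_classical all_reals all_analysis.
Set Implicit Arguments. Unset Strict Implicit. Unset Printing Implicit Defensive.
Import Order.TTheory GRing.Theory Num.Theory.
Local Open Scope classical_set_scope.
Local Open Scope ring_scope.

Section Defs.
Context {R : realType} {disp : measure_display} {X : measurableType disp}.
Variables (d : X -> X -> R) (f : X -> X).

Definition is_metric : Prop :=
  [/\ forall x y, d x y = 0 <-> x = y,
      forall x y, d x y = d y x &
      forall x y z, d x z <= d x y + d y z].

Definition dopen (U : set X) : Prop :=
  forall x, U x -> exists r : R, 0 < r /\ [set y | d x y < r] `<=` U.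

Definition dcompact : Prop :=
  forall (I : Type) (U : I -> set X), (forall i, dopen (U i)) ->
    (forall x, exists i, U i x) ->
    exists F : seq I, forall x, exists2 i, List.In i F & U i x.

Definition borel_structure : Prop :=
  (@measurable _ X : set (set X)) = <<s dopen >>.

Definition dcontinuous : Prop :=
  forall x (e : R), 0 < e -> exists del : R, 0 < del /\
    forall y, d x y < del -> d (f x) (f y) < e.

Definition pos_expansive : Prop :=
  exists rho : R, 0 < rho /\
    forall x y, x <> y -> exists n, rho < d (iter n f x) (iter n f y).

(* specification property (blocks indexed 0..k-1;
   m_{j-1} = \sum_(l < j) (n_l + s_l)) *)
Definition specification : Prop :=
  forall e : R, 0 < e -> exists n0 : nat,
    forall (k : nat) (x : nat -> X) (n s : nat -> nat),
      (forall j, (j < k)%N -> (n0 <= s j)%N) ->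
      exists p : X, forall j, (j < k)%N -> forall i, (i < n j)%N ->
        d (iter ((\sum_(l < j) (n l + s l)) + i)%N f p) (iter i f (x j)) < e.

Definition dn (n : nat) (x y : X) : R :=
  \big[Num.max/0]_(i < n) d (iter i f x) (iter i f y).

(* least natural number satisfying P (0 if none) *)
Definition minnat (P : nat -> Prop) : nat :=
  match pselect (exists k, P k) with
  | left h => @ex_minn (fun k => `[< P k >]) (let: ex_intro k hk := h in
                        ex_intro _ k (asboolT hk))
  | right _ => 0%N
  end.

Definition span_num (n : nat) (e : R) : nat :=
  minnat (fun k => exists E : seq X, size E = k /\
            forall x, exists2 y, y \in E & dn n x y <= e).

Local Open Scope ereal_scope.

Definition htop : \bar R :=
  lim ((fun e : R => limn_esup
          (fun n : nat => ((n%:R)^-1 * ln (span_num n e)%:R)%R%:E)) @ 0^'+).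

Definition coupling (mu nu : probability X R) (pi : probability (X * X)%type R)
  : Prop :=
  forall A, measurable A ->
    pi (A `*` setT) = mu A /\ pi (setT `*` A) = nu A.

Definition W1n (n : nat) (mu nu : probability X R) : \bar R :=
  ereal_inf [set (\int[pi]_z (dn n z.1 z.2)%:E) | pi in coupling mu nu].

Definition NM (Z : set (probability X R)) (n : nat) (e : R) : nat :=
  minnat (fun k => exists E : seq (probability X R), size E = k /\
            forall mu, Z mu -> exists2 nu, nu \in E & W1n n mu nu <= e%:E).

Definition entM (Z : set (probability X R)) : \bar R :=
  lim ((fun e : R => limn_esup
          (fun n : nat => ((n%:R)^-1 * ln (ln (NM Z n e)%:R))%R%:E)) @ 0^'+).

Definition invariant (mu : probability X R) : Prop :=
  forall A, measurable A -> mu (f @^-1` A) = mu A.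

Definition ergodic (mu : probability X R) : Prop :=
  forall A, measurable A -> f @^-1` A = A -> mu A = 0 \/ mu A = 1.

Definition periodic_point (x : X) : Prop := exists p, (0 < p)%N /\ iter p f x = x.

Definition orbit (x : X) : set X := [set iter i f x | i in setT].

Definition Mper : set (probability X R) :=
  [set mu | invariant mu /\ ergodic mu /\
            exists x, periodic_point x /\ mu (orbit x) = 1].

End Defs.

(* Main.v *)
(** Upper bound: an [(n, e)]-spanning set of [K] points carries, up to [W1n]-error
   [2 e], every finitely supported probability once its weights are rounded to
   multiples of [1/M] with [M] proportional to [K]; hence [ln ln N <= ln K + O(ln ln K)].

   Lower bound: specification and positive expansivity give periodic specification.
   Indeed compactness and expansivity let a shadowing orbit land exactly on a given
   point, and a pair "past orbit segment, future point" with as few connecting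
   segments as possible is synchronizing, so orbits can be closed up.  Take [K] points
   that are [(m, e)]-separated and, for each word of length [P] in these letters, a
   periodic orbit shadowing it with gaps [N]; put [n = m + N].  If the measures of two
   such orbits are [W1n]-close to the same measure, most length-[n] windows of the one
   are close to windows of the other, and these windows tile time, so a word is
   determined, up to few letters, by one of [P n + O(1)] positions for each window.
   Counting the [K ^ P] words, with [P] about [K ^ (1 - theta)], forces
   [ln N >= P], that is, [ln ln N >= (1 - theta) ln K]. *)
Require Import Defs.
From HB Require Import structures.
From mathcomp Require Import all_boot all_order all_algebra.
From mathcomp Require Import all_classical all_reals all_analysis.
From mathcomp Require Import measurable_realfun lra ring zify.
Set Implicit Arguments. Unset Strict Implicit. Unset Printing Implicit Defensive.
Import Order.TTheory GRing.Theory Num.Theory.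
Local Open Scope classical_set_scope.
Local Open Scope ring_scope.

(** * Compact metric dynamics *)

Section CompactMetric.
Context {R : realType} {disp : measure_display} {X : measurableType disp}.
Variables (d : X -> X -> R) (f : X -> X).
Hypotheses (dM : is_metric d) (dK : dcompact d) (fC : dcontinuous d f).

Lemma dist_refl x : d x x = 0.
Proof. by have [H _ _] := dM; apply/H. Qed.

Lemma dist_sym x y : d x y = d y x.
Proof. by have [_ H _] := dM; exact: H. Qed.

Lemma dist_triangle y x z : d x z <= d x y + d y z.
Proof. by have [_ _ H] := dM; exact: H. Qed.

Lemma dist_ge0 x y : 0 <= d x y.
Proof.
have := dist_triangle y x x; rewrite dist_refl (dist_sym y x).
by rewrite -mulr2n pmulrn_lge0.
Qed.

Lemma dn_leP n x y (e : R) : 0 <= e ->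
  (dn d f n x y <= e) <-> (forall i, (i < n)%N -> d (iter i f x) (iter i f y) <= e).
Proof.
move=> e0; split.
  by move=> /bigmax_leP[_ H] i ni; exact: (H (Ordinal ni)).
by move=> H; apply/bigmax_leP; split => // i _; exact: H.
Qed.

Lemma dn_ge0 n x y : 0 <= dn d f n x y.
Proof. by apply: bigmax_ge_id. Qed.

Lemma dist_le_dn n i x y : (i < n)%N -> d (iter i f x) (iter i f y) <= dn d f n x y.
Proof. by move=> ni; move: i ni; apply/dn_leP => //; exact: dn_ge0. Qed.

Lemma dn_sym n x y : dn d f n x y = dn d f n y x.
Proof. by apply: eq_bigr => i _; rewrite dist_sym. Qed.

Lemma dn_triangle n y x z : dn d f n x z <= dn d f n x y + dn d f n y z.
Proof.
apply/dn_leP; first by rewrite addr_ge0 ?dn_ge0.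
move=> i ni; apply: (le_trans (dist_triangle (iter i f y) _ _)).
by rewrite lerD ?dist_le_dn.
Qed.

Lemma dn_refl n x : dn d f n x x = 0.
Proof.
apply/eqP; rewrite eq_le dn_ge0 andbT; apply/dn_leP => // i _.
by rewrite dist_refl.
Qed.

Lemma iter_dcontinuous i : dcontinuous d (iter i f).
Proof.
elim: i => [|i IH] x e e0; first by exists e.
have [r [r0 Hr]] := fC (iter i f x) e0.
have [s [s0 Hs]] := IH x _ r0.
by exists s; split => // y xy; apply: Hr; exact: Hs.
Qed.

Lemma dn_continuous n x (e : R) : 0 < e ->
  exists r : R, 0 < r /\ forall y, d x y < r -> dn d f n x y < e.
Proof.
move=> e0; suff [r [r0 Hr]] : exists r : R, 0 < r /\ forall y, d x y < r ->
    forall i, (i < n)%N -> d (iter i f x) (iter i f y) <= e / 2.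
  exists r; split => // y /Hr/dn_leP xy.
  by rewrite (le_lt_trans (xy _)) ?divr_ge0 ?ltW// ltr_pdivrMr// ltr_pMr// ltr1n.
elim: n => [|n [r [r0 Hr]]]; first by exists 1.
have e20 : 0 < e / 2 by rewrite divr_gt0.
have [s [s0 Hs]] := iter_dcontinuous n x e20.
exists (Num.min r s); split; first by rewrite lt_min r0.
move=> y; rewrite lt_min => /andP[xr xs] i; rewrite ltnS leq_eqVlt.
by move=> /predU1P[->|]; [exact/ltW/Hs|exact: Hr].
Qed.

(** If there were none, every point would have a ball missing a tail of [u]; finitely many such
    balls cover the space, so some [u m] would lie in no ball of the cover. *)
Lemma cluster_point (u : nat -> X) : exists x, forall (e : R), 0 < e ->
  forall n, exists2 k, (n <= k)%N & d x (u k) < e.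
Proof.
apply: contrapT => H.
have {}H x : exists p : R * nat, 0 < p.1 /\ forall k, (p.2 <= k)%N -> p.1 <= d x (u k).
  apply: contrapT => Hx; apply: H; exists x => e e0 n.
  apply: contrapT => Hk; apply: Hx; exists (e, n); split => //= k nk.
  by rewrite leNgt; apply/negP => ?; apply: Hk; exists k.
have [p Hp] := choice H.
have [||F HF] := dK (U := fun x => [set y | d x y < (p x).1]).
- move=> x y /= xy; exists ((p x).1 - d x y); split; first by rewrite subr_gt0.
  move=> z /=; rewrite ltrBrDl; apply: le_lt_trans; exact: dist_triangle.
- by move=> x; exists x; rewrite /= dist_refl; have [] := Hp x.
have [m Hm] : exists m, forall x, List.In x F -> ((p x).2 <= m)%N.
  elim: F {HF} => [|a F [m IH]]; first by exists 0%N.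
  exists (maxn m (p a).2) => x /= [<-|/IH]; first exact: leq_maxr.
  by move=> /leq_trans; apply; exact: leq_maxl.
have [x xF] := HF (u m); rewrite /= ltNge => /negP; apply.
by have [_] := Hp x; apply; exact: Hm.
Qed.

(** This makes [span_num] an attained minimum rather than the default value of [minnat]. *)
Lemma finite_net n (e : R) : 0 < e ->
  exists E : seq X, forall x, exists2 y, y \in E & dn d f n x y <= e.
Proof.
move=> e0; have H x := dn_continuous n x e0.
have [r Hr] := choice H.
have [||F HF] := dK (U := fun x => [set y | d x y < r x]).
- move=> x y /= xy; exists (r x - d x y); split; first by rewrite subr_gt0.
  move=> z /=; rewrite ltrBrDl; apply: le_lt_trans; exact: dist_triangle.
- by move=> x; exists x; rewrite /= dist_refl; have [] := Hr x.
exists F => x; have [y yF yx] := HF x.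
exists y; last by rewrite dn_sym ltW//; apply (Hr y).2.
by elim: F yF {HF} => //= a F IH [->|/IH]; rewrite inE ?eqxx// => ->; rewrite orbT.
Qed.

Lemma dist_bounded : exists2 D : R, 0 < D & forall x y, d x y <= D.
Proof.
have [F HF] := @finite_net 1 1 ltr01.
have [D D0 HD] : exists2 D : R, 0 < D & forall x, x \in F -> d point x <= D.
  elim: F {HF} => [|a F [D D0 IH]]; first by exists 1.
  exists (D + d point a); first by rewrite ltr_pwDl ?dist_ge0.
  move=> x; rewrite inE => /orP[/eqP->|/IH h]; first by rewrite lerDr ltW.
  by rewrite (le_trans h)// lerDl dist_ge0.
exists (2 * (D + 1)); first lra.
have H x : d point x <= D + 1.
  have [y yF xy] := HF x.
  apply: (le_trans (dist_triangle y _ _)); rewrite lerD ?HD// dist_sym.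
  by move/(dn_leP _ _ _ ler01) : xy => /(_ 0%N); exact.
move=> x y; apply: (le_trans (dist_triangle point _ _)).
by rewrite dist_sym; have := H x; have := H y; lra.
Qed.

Lemma dn_bounded : exists2 D : R, 0 < D & forall n x y, dn d f n x y <= D.
Proof.
have [D D0 HD] := dist_bounded; exists D => // n x y.
by apply/dn_leP => //; exact: ltW.
Qed.

Lemma minnatP (P : nat -> Prop) : (exists k, P k) -> P (minnat P).
Proof.
rewrite /minnat => h; case: pselect => // h'.
by case: ex_minnP => m /asboolP.
Qed.

Lemma minnat_le (P : nat -> Prop) k : P k -> (minnat P <= k)%N.
Proof.
rewrite /minnat => Pk; case: pselect => // h'.
by case: ex_minnP => m _; apply; apply/asboolP.
Qed.

Lemma span_numP n (e : R) : 0 < e -> exists E : seq X, size E = span_num d f n e /\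
  forall x, exists2 y, y \in E & dn d f n x y <= e.
Proof.
move=> e0; apply: (@minnatP (fun k => exists E : seq X, size E = k /\
   forall x, exists2 y, y \in E & dn d f n x y <= e)).
by have [E HE] := finite_net n e0; exists (size E), E.
Qed.

Lemma span_num_gt0 n (e : R) : 0 < e -> (0 < span_num d f n e)%N.
Proof.
move=> /(span_numP n)[E [<- /(_ point)[y]]].
by case: E.
Qed.

Lemma span_num_le n (e1 e2 : R) : 0 < e1 -> e1 <= e2 ->
  (span_num d f n e2 <= span_num d f n e1)%N.
Proof.
move=> e10 e12; have [E [sE HE]] := span_numP n e10.
apply: minnat_le; exists E; split => // x; have [y yE xy] := HE x.
by exists y => //; exact: le_trans e12.
Qed.

(** Greedy choice: fewer than [span_num] points never span, so some point is more than [e] away from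
    all those chosen so far. *)
Lemma separated_seq n (e : R) k : (k <= span_num d f n e)%N ->
  exists x : nat -> X, forall i j, (i < j < k)%N -> e < dn d f n (x i) (x j).
Proof.
elim: k => [|k IH] kS; first by exists (fun=> point) => i j; rewrite ltn0 andbF.
have [x Hx] := IH (ltnW kS).
have [y Hy] : exists y, forall i, (i < k)%N -> e < dn d f n (x i) y.
  apply: contrapT => H; move: kS; rewrite ltnNge => /negP; apply.
  apply: minnat_le; exists (mkseq x k); split; first by rewrite size_mkseq.
  move=> y; apply: contrapT => Hy; apply: H; exists y => i ik.
  rewrite ltNge; apply/negP => yi; apply: Hy; exists (x i); last by rewrite dn_sym.
  by apply/mapP; exists i; rewrite ?mem_iota.
exists (fun i => if i == k then y else x i) => i j /andP[ij].
rewrite ltnS leq_eqVlt => /orP[/eqP jk|jk].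
  by subst j; rewrite eqxx (ltn_eqF ij) Hy.
by rewrite !ltn_eqF// ?(ltn_trans ij)// Hx// ij.
Qed.

End CompactMetric.

(** * Periodic specification *)

Section PeriodicSpecification.
Context {R : realType} {disp : measure_display} {X : measurableType disp}.
Variables (d : X -> X -> R) (f : X -> X).
Hypotheses (dM : is_metric d) (dK : dcompact d) (fC : dcontinuous d f).

(** Closed conditions on a tail of [u] pass to its cluster points by continuity of [iter i f]; no
    subsequence has to be extracted. *)
Lemma cluster_dist_le (u : nat -> X) x :
  (forall e : R, 0 < e -> forall n, exists2 k, (n <= k)%N & d x (u k) < e) ->
  forall i y (c : R) K, (forall k, (K <= k)%N -> d (iter i f (u k)) y <= c) ->
  d (iter i f x) y <= c.
Proof.
move=> xu i y c K H; rewrite leNgt; apply/negP => cx.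
have [r [r0 Hr]] : exists r : R, 0 < r /\
    forall z, d x z < r -> d (iter i f x) (iter i f z) < d (iter i f x) y - c.
  by apply: (iter_dcontinuous fC); rewrite subr_gt0.
have [k Kk /Hr] := xu _ r0 K.
have := dist_triangle dM (iter i f (u k)) (iter i f x) y.
by have := H _ Kk; lra.
Qed.

Variable rho : R.
Hypothesis rho0 : 0 < rho.
Hypothesis rhoE : forall x y, x <> y -> exists n, rho < d (iter n f x) (iter n f y).

Lemma expansive_eq x y :
  (forall n, d (iter n f x) (iter n f y) <= rho) -> x = y.
Proof.
move=> H; apply: contrapT => /rhoE[n]; rewrite ltNge => /negP; apply; exact: H.
Qed.

(** Counterexamples for all [M] would accumulate at a point that stays [rho]-close to [y] forever,
    hence at [y] itself, although they keep distance [r] from it. *)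
Lemma uniform_expansive y (r : R) : 0 < r -> exists M, forall m, (M <= m)%N ->
  forall z, dn d f m z y <= rho -> d y z < r.
Proof.
move=> r0; apply: contrapT => H.
have {}H M : exists z, dn d f M z y <= rho /\ r <= d y z.
  apply: contrapT => Hz; apply: H; exists M => m Mm z mz.
  rewrite ltNge; apply/negP => rz; apply: Hz; exists z; split => //.
  apply/dn_leP; first exact: ltW.
  by move=> i iM; move/(dn_leP _ _ _ _ _ (ltW rho0)) : mz; apply; exact: leq_trans Mm.
have [u Hu] := choice H.
have [z zu] := cluster_point dM dK u.
have zy : z = y.
  apply: expansive_eq => i; apply: (cluster_dist_le zu (K := i.+1)) => k ik.
  by have [/(dn_leP _ _ _ _ _ (ltW rho0)) + _] := Hu k; apply.
have [k _] := zu _ r0 0%N; rewrite zy; have [_] := Hu k; lra.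
Qed.

(* The last block is the whole forward orbit of [y]: expansivity turns shadowing
   it into hitting it exactly. *)
Lemma specification_landing (e : R) : specification d f -> 0 < e -> e <= rho ->
  exists N, forall k (x : nat -> X) (n : nat -> nat) y, exists z,
    (forall j, (j < k)%N -> forall i, (i < n j)%N ->
       d (iter ((\sum_(l < j) (n l + N)) + i)%N f z) (iter i f (x j)) <= e) /\
    iter (\sum_(l < k) (n l + N))%N f z = y.
Proof.
move=> fS e0 erho; have [N HN] := fS e e0; exists N => k x n y.
pose x' j := if (j < k)%N then x j else y.
(* The last block has length [t]; a cluster point as [t] grows follows all of the orbit of [y]. *)
pose n' t j := if (j < k)%N then n j else t.
have H t := HN k.+1 x' (n' t) (fun=> N) (fun j _ => leqnn N).
have {H}[u Hu] := choice H.
have n'E t j : (j <= k)%N -> (\sum_(l < j) (n' t l + N) = \sum_(l < j) (n l + N))%N.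
  by move=> jk; apply: eq_bigr => l _; rewrite /n' (leq_trans (ltn_ord l) jk).
have [z zu] := cluster_point dM dK u.
exists z; split.
  move=> j jk i ij; apply: (cluster_dist_le zu (K := 0%N)) => t _; apply: ltW.
  have := Hu t j (ltnW jk) i; rewrite /x' {1}/n' jk n'E; last exact: ltnW.
  by apply.
apply: expansive_eq => i; apply: le_trans erho.
rewrite -iterD addnC; apply: (cluster_dist_le zu (K := i.+1)) => t it; apply: ltW.
by have := Hu t k (ltnSn k) i; rewrite /x' {1}/n' ltnn n'E//; exact.
Qed.

(** Two points of [A] near the same element of [s] are within [2 * e], hence equal, so one
    representative per element of [s] exhausts [A]. *)
Lemma separated_cover (A : set X) N (e : R) (s : seq X) :
  (forall w w', A w -> A w' -> dn d f N w w' <= 2 * e -> w = w') ->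
  (forall w, A w -> exists2 y, y \in s & dn d f N w y <= e) ->
  exists s', size s' = size s /\ forall w, A w -> w \in s'.
Proof.
move=> Asep As.
have H y : exists g, (exists2 w, A w & dn d f N w y <= e) -> A g /\ dn d f N g y <= e.
  have [[w Aw wy]|nw] := pselect (exists2 w, A w & dn d f N w y <= e).
    by exists w.
  by exists point.
have [g Hg] := choice H.
exists (map g s); split; first by rewrite size_map.
move=> w Aw; have [y ys wy] := As w Aw.
have [Ag gy] : A (g y) /\ dn d f N (g y) y <= e by apply: Hg; exists w.
rewrite (Asep w (g y))//; first by apply: map_f.
have := dn_triangle f dM N y w (g y); rewrite (dn_sym f dM N y (g y)); lra.
Qed.

Lemma preimage_separated N w w' : iter N f w = iter N f w' ->
  dn d f N w w' <= rho -> w = w'.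
Proof.
move=> ww' /(dn_leP _ _ _ _ _ (ltW rho0)) H; apply: expansive_eq => n.
have [|Nn] := ltnP n N; first exact: H.
by rewrite -(subnK Nn) !iterD ww' dist_refl// ltW.
Qed.

(** * Synchronizing connections and closing of orbits *)

Section Synchronization.
Variables (e : R) (N : nat).
Hypotheses (e0 : 0 < e) (e2rho : 2 * e <= rho).
Hypothesis landing : forall k (x : nat -> X) (n : nat -> nat) y, exists z,
    (forall j, (j < k)%N -> forall i, (i < n j)%N ->
       d (iter ((\sum_(l < j) (n l + N)) + i)%N f z) (iter i f (x j)) <= e) /\
    iter (\sum_(l < k) (n l + N))%N f z = y.

(* The connections of length [N] from the orbit segment [(x, m)] to [y]. *)
Let C (x : X) (m : nat) (y : X) : set X :=
  [set w | iter N f w = y /\ exists2 v, dn d f m v x <= e & iter m f v = w].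

Let C_separated x m y w w' : C x m y w -> C x m y w' ->
  dn d f N w w' <= 2 * e -> w = w'.
Proof.
move=> [wy _] [wy' _] ww'; apply: (@preimage_separated N); first by rewrite wy.
exact: le_trans e2rho.
Qed.

Let C_nonempty x m y : C x m y !=set0.
Proof.
have [z [Hz zy]] := landing 1 (fun=> x) (fun=> m) y.
exists (iter m f z); split; first by rewrite -iterD addnC -zy big_ord1.
exists z => //; apply/dn_leP; first exact: ltW.
by move=> i im; have := Hz 0%N isT i im; rewrite big_ord0.
Qed.

(** Prolonging the past of [x] back to [z] puts more constraints on a connecting orbit, so it can
    only remove connections. *)
Let C_subset T x m z y : iter T f z = x -> C z (T + m)%N y `<=` C x m y.
Proof.
move=> zx w [wy [v vz vw]]; split => //; exists (iter T f v); last by rewrite -iterD addnC.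
apply/dn_leP; first exact: ltW.
move=> i im; rewrite -zx -!iterD; move/(dn_leP _ _ _ _ _ (ltW e0)) : vz; apply.
by rewrite addnC ltn_add2l.
Qed.

(** Upper semicontinuity: connections to targets tending to [y] that stay more than [e] away from
    [s] would accumulate at a connection to [y], which belongs to [s]. *)
Let C_usc x m y (s : seq X) : C x m y `<=` [set` s] -> exists2 r : R, 0 < r &
  forall y', d y y' < r -> forall w, C x m y' w -> exists2 w0, w0 \in s & dn d f N w w0 <= e.
Proof.
move=> Cs; apply: contrapT => H.
have {}H k : exists v, [/\ d y (iter (N + m) f v) < k.+1%:R^-1, dn d f m v x <= e &
    forall w0, w0 \in s -> e < dn d f N (iter m f v) w0].
  apply: contrapT => Hk; apply: H; exists k.+1%:R^-1; first by rewrite invr_gt0.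
  move=> y' yy' w [wy' [v vx vw]]; apply: contrapT => Hw; apply: Hk; exists v.
  rewrite iterD vw wy'; split => // w0 w0s; rewrite ltNge; apply/negP => ww0.
  by apply: Hw; exists w0.
have [u Hu] := choice H.
have [v vu] := cluster_point dM dK u.
have vs : iter m f v \in s.
  apply: Cs; split; last first.
    exists v => //; apply/dn_leP; first exact: ltW.
    move=> i im; apply: (cluster_dist_le vu (K := 0%N)) => k _.
    by have [_ /(dn_leP _ _ _ _ _ (ltW e0)) + _] := Hu k; apply.
  rewrite -iterD; have [dist_eq0 _ _] := dM; apply/dist_eq0.
  apply/eqP; rewrite eq_le dist_ge0// andbT.
  apply/ler_addgt0Pl => a a0; rewrite addr0.
  apply: (cluster_dist_le vu (K := Num.truncn a^-1)) => k ak.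
  rewrite dist_sym//; have [/ltW + _ _] := Hu k.
  move=> /le_trans; apply; rewrite invf_ple ?posrE//.
  by apply: ltW; apply: lt_le_trans (truncnS_gt _) _; rewrite ler_nat.
have [r [r0 Hr]] := dn_continuous fC N (iter m f v) e0.
have [r' [r'0 Hr']] := iter_dcontinuous fC m v r0.
have [k _ /Hr'/Hr] := vu _ r'0 0%N.
by have [_ _ /(_ _ vs)] := Hu k; rewrite dn_sym//; lra.
Qed.

(* Bertrand's argument: take [(x0, m0, y0)] whose set of connections is covered by
   the fewest points.  Neither perturbing [y0] nor extending [(x0, m0)] to the past
   can then destroy a connection. *)
Lemma synchronizing : exists x0 m0 y0 w1 (r : R), 0 < r /\
  forall y', d y0 y' < r -> forall T z0, iter T f z0 = x0 ->
  exists z, [/\ dn d f (T + m0) z z0 <= e, dn d f N (iter (T + m0) f z) w1 <= e &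
    iter (T + m0 + N) f z = y'].
Proof.
pose P c := exists x m y (s : seq X), size s = c /\ C x m y `<=` [set` s].
have [x0 [m0 [y0 [s [sc Cs]]]]] : P (minnat P).
  (* Connections are separated, so a finite net bounds their number and the minimum exists. *)
  apply: minnatP; have [E HE] := finite_net dM dK fC N e0.
  have [||s [ss Cs]] := @separated_cover (C point 0 point) N e E.
  - exact: C_separated.
  - by move=> w _; exact: HE.
  by exists (size E), point, 0%N, point, s.
case: s sc Cs => [|w1 s] sc Cs.
  by have [w /Cs] := C_nonempty x0 m0 y0.
have [r r0 Hr] := C_usc Cs.
exists x0, m0, y0, w1, r; split => // y' yy' T z0 z0x0.
have [[w [wy' [z zz0 zw]] ww1]|H] :=
  pselect (exists2 w, C z0 (T + m0) y' w & dn d f N w w1 <= e).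
  by exists z; rewrite zw (addnC (T + m0)%N N) iterD zw.
(* Without a connection near [w1], the shorter list [s] would account for all connections of the
   prolonged segment, against minimality. *)
exfalso; have [||s' [ss' Cs']] := @separated_cover (C z0 (T + m0) y') N e s.
- exact: C_separated.
- move=> w Cw; have [w0] := Hr _ yy' _ (C_subset z0x0 Cw).
  rewrite inE => /predU1P[->|]; last by exists w0.
  by move=> ww1; exfalso; apply: H; exists w.
have : (minnat P <= size s)%N by apply: minnat_le; exists z0, (T + m0)%N, y', s'.
by rewrite -sc ltnn.
Qed.

(** Let [z0] follow [y0], then all the letters, and land on [x0]. For [y'] near [y0],
    synchronization yields [g y'], which follows [z0], then [w1], and lands on [y'] after [T] steps.
    As [g y'] starts along [y0], it is again near [y0], so [g] can be iterated. A cluster point of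
    the iterates follows a [T]-periodic itinerary forever, and expansivity makes it periodic. *)
Lemma periodic_tracing : exists Q, forall m P (x : nat -> X), exists z,
  iter (P * (m + N) + Q) f z = z /\
  forall j i, (j < P)%N -> (i < m)%N ->
    d (iter (j * (m + N) + i) f z) (iter i f (x j)) <= 2 * e.
Proof.
have [x0 [m0 [y0 [w1 [r [r0 sync]]]]]] := synchronizing.
have [M' HM'] := uniform_expansive y0 r0.
(* The successor keeps the period [T] positive even if [P], [N] and [m0] vanish. *)
pose M := M'.+1; have {}HM' z : dn d f M z y0 <= 2 * e -> d y0 z < r.
  by move=> zy0; apply: (HM' M) => //; exact: le_trans e2rho.
exists (M + N + m0 + N)%N => m P x.
pose bx j := if j is j'.+1 then x j' else y0.
pose bn j := if j is j'.+1 then m else M.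
have sumE j : (\sum_(l < j.+1) (bn l + N) = M + N + j * (m + N))%N.
  by rewrite big_ord_recl /= big_const_ord iter_addn_0 mulnC.
have [z0 [Hz0 z0x0]] := landing P.+1 bx bn x0; rewrite sumE in z0x0.
set T0 := (M + N + P * (m + N))%N in z0x0.
pose T := (T0 + m0 + N)%N.
have T_gt0 : (0 < T)%N by rewrite /T /T0 /M; lia.
have z0y0 : dn d f M z0 y0 <= e.
  apply/dn_leP; first exact: ltW.
  by move=> i iM; have := Hz0 0%N isT i iM; rewrite big_ord0.
have Hg y' : exists z, d y0 y' < r -> [/\ dn d f (T0 + m0) z z0 <= e,
    dn d f N (iter (T0 + m0) f z) w1 <= e & iter T f z = y'].
  have [yy'|] := pselect (d y0 y' < r); last by exists point.
  by have [z Hz] := sync _ yy' _ _ z0x0; exists z.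
have {Hg}[g Hg] := choice Hg.
have gV y' : d y0 y' < r -> d y0 (g y') < r.
  move=> /Hg[gz0 _ _]; apply: HM'.
  apply: (le_trans (dn_triangle f dM _ z0 _ _)).
  suff : dn d f M (g y') z0 <= e by lra.
  apply/dn_leP; first exact: ltW.
  move=> i iM; move/(dn_leP _ _ _ _ _ (ltW e0)) : gz0; apply.
  by rewrite /T0; lia.
pose u k := iter k g y0.
have uV k : d y0 (u k) < r.
  by elim: k => [|k IH]; [rewrite /u /= dist_refl|exact: gV].
(* The periodic itinerary: [T0 + m0] steps along [z0], then [N] steps along [w1]. *)
pose q t := if (t %% T < T0 + m0)%N then iter (t %% T) f z0
  else iter (t %% T - (T0 + m0)) f w1.
have uq k t : (t < k * T)%N -> d (iter t f (u k)) (q t) <= e.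
  elim: k t => [//|k IH] t tk.
  have [a b c] := Hg _ (uV k).
  have [tT|Tt] := ltnP t T.
    rewrite /q modn_small//; case: ifPn => tT0.
      by move/(dn_leP _ _ _ _ _ (ltW e0)) : a; apply.
    rewrite -leqNgt in tT0.
    rewrite -[X in iter X f (u _)](subnK tT0) iterD.
    by move/(dn_leP _ _ _ _ _ (ltW e0)) : b; apply; rewrite /T in tT; lia.
  rewrite -(subnK Tt) iterD -/(u k.+1) [iter T f _]c /q modnDr.
  by apply: IH; lia.
have [z zu] := cluster_point dM dK u.
have zq t : d (iter t f z) (q t) <= e.
  apply: (cluster_dist_le zu (K := t.+1)) => k tk; apply: uq; nia.
have zT : iter T f z = z.
  apply: expansive_eq => t; apply: le_trans e2rho.
  apply: (le_trans (dist_triangle dM (q t) _ _)).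
  rewrite -iterD (dist_sym dM (q t)); have := zq t.
  by have := zq (t + T)%N; rewrite /q modnDr; lra.
(* Skipping the opening block [y0] and its gap puts the first letter at time [0]. *)
exists (iter (M + N) f z); split.
  rewrite -iterD addnC iterD; congr (iter _ f _).
  by rewrite -[RHS]zT; congr (iter _ f _); rewrite /T /T0; lia.
move=> j i jP im; rewrite -iterD.
set t := (j * (m + N) + i + (M + N))%N.
have tT0 : (t < T0)%N by rewrite /t /T0; nia.
apply: (le_trans (dist_triangle dM (iter t f z0) _ _)).
have := zq t; rewrite /q modn_small; last by rewrite /T; lia.
rewrite ltn_addr//.
have tE : (M + N + j * (m + N) + i)%N = t by rewrite /t; lia.
suff : d (iter t f z0) (iter i f (x j)) <= e by lra.
by rewrite -tE -sumE; exact: (Hz0 j.+1).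
Qed.

End Synchronization.
End PeriodicSpecification.

(** What matters is uniformity: [N] and [Q] depend on [e] alone, so their cost becomes negligible
    for long segments. *)
Lemma periodic_specification {R : realType} {disp : measure_display}
  {X : measurableType disp} (d : X -> X -> R) (f : X -> X) (e : R) :
  is_metric d -> dcompact d -> dcontinuous d f -> pos_expansive d f ->
  specification d f -> 0 < e ->
  exists N Q, forall m P (x : nat -> X), exists z,
    iter (P * (m + N) + Q) f z = z /\
    forall j i, (j < P)%N -> (i < m)%N ->
      d (iter (j * (m + N) + i) f z) (iter i f (x j)) <= e.
Proof.
move=> dM dK fC [rho [rho0 rhoE]] fS e0.
(* Tracing costs [2 * e'], which has to stay below both [e] and [rho]. *)
pose e' := Num.min e rho / 2.
have e'0 : 0 < e' by rewrite divr_gt0// lt_min e0.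
have e'2 : 2 * e' = Num.min e rho by rewrite /e'; lra.
have e'e : 2 * e' <= e by rewrite e'2 ge_min lexx.
have e'rho : 2 * e' <= rho by rewrite e'2 ge_min lexx orbT.
have [|N HN] := specification_landing dM dK fC rhoE fS e'0; first lra.
exists N; have [Q HQ] := periodic_tracing dM dK fC rho0 rhoE e'0 e'rho HN.
exists Q => m P x; have [z [zT Hz]] := HQ m P x; exists z; split => // j i jP im.
exact: le_trans (Hz _ _ jP im) _.
Qed.

(** * Measures and transport plans *)

Section Measurability.
Context {R : realType} {disp : measure_display} {X : measurableType disp}.
Variables (d : X -> X -> R) (f : X -> X).
Hypotheses (dM : is_metric d) (dK : dcompact d) (dB : borel_structure d).
Hypothesis (fC : dcontinuous d f).

Lemma dopen_measurable (U : set X) : dopen d U -> measurable U.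
Proof. by rewrite dB; exact: sub_sigma_algebra. Qed.

Lemma ball_dopen x (r : R) : dopen d [set y | d x y < r].
Proof.
move=> y /= xy; exists (r - d x y); split; first by rewrite subr_gt0.
move=> z /=; rewrite ltrBrDl; apply: le_lt_trans; exact: dist_triangle.
Qed.

Lemma measurable_fun_ltP d' (T : measurableType d') (g : T -> R) :
  (forall r, measurable [set x | g x < r]) -> measurable_fun setT g.
Proof.
move=> H; apply: (measurability (@RGenInftyO.G R)).
  exact: RGenInftyO.measurableE.
move=> _ [_ [r ->] <-]; rewrite setTI; exact: H.
Qed.

Lemma measurable_fun_lt d' (T : measurableType d') (g : T -> R) r :
  measurable_fun setT g -> measurable [set x | g x < r].
Proof.
move=> mg; rewrite (_ : mkset _ = setT `&` g @^-1` `]-oo, r[%classic).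
  exact: mg.
by rewrite setTI; apply/seteqP; split => x /=; rewrite in_itv.
Qed.

Lemma dcontinuous_measurable : measurable_fun setT f.
Proof.
apply: (measurability (dopen d)); first exact: dB.
move=> _ [U oU <-]; rewrite setTI; apply: dopen_measurable => x Ufx.
have [r [r0 Hr]] := oU _ Ufx; have [s [s0 Hs]] := fC x r0.
by exists s; split => // y /Hs/Hr.
Qed.

Lemma iter_measurable i : measurable_fun setT (iter i f).
Proof.
elim: i => [|i IH]; first exact: measurable_id.
exact: (measurableT_comp dcontinuous_measurable IH).
Qed.

Lemma measurable_dist_point x : measurable_fun setT (d x).
Proof.
by apply: measurable_fun_ltP => r; apply: dopen_measurable; exact: ball_dopen.
Qed.

(** The sigma-algebra on [X * X] is the product one, so the sets [d x y < r] are written as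
    countable unions of conditions on [d q x + d q y], with [q] in finite nets of mesh tending to
    [0]. *)
Lemma measurable_dist : measurable_fun setT (fun z : X * X => d z.1 z.2).
Proof.
have idC : dcontinuous d id by move=> x e e0; exists e.
have H (k : nat) : exists E : seq X, forall x, exists2 y, y \in E & d x y <= k.+1%:R^-1.
  have k0 : 0 < k.+1%:R^-1 :> R by rewrite invr_gt0.
  have [E HE] := finite_net dM dK idC 1 k0; exists E => x.
  have [y yE xy] := HE x; exists y => //.
  by move/(dn_leP _ _ _ _ _ (ltW k0)) : xy => /(_ 0%N isT).
have {H}[E HE] := choice H.
apply: measurable_fun_ltP => r.
rewrite (_ : mkset _ = \bigcup_(k in [set: nat]) \bigcup_(i in [set: nat])
   [set z : X * X | d (nth point (E k) i) z.1 + d (nth point (E k) i) z.2 < r]).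
  apply: bigcupT_measurable => k; apply: bigcupT_measurable => i.
  apply: measurable_fun_lt; apply: measurable_funD.
    exact: (measurableT_comp (measurable_dist_point _) measurable_fst).
  exact: (measurableT_comp (measurable_dist_point _) measurable_snd).
apply/seteqP; split => [[x y]/= xyr|[x y]/= [k _ [i _]]]; last first.
  apply: le_lt_trans; rewrite (dist_sym dM _ x); exact: dist_triangle.
pose a := (r - d x y) / 2; have a0 : 0 < a by rewrite divr_gt0// subr_gt0.
pose k := Num.truncn a^-1.
have [q qE xq] := HE k x.
have {xq}xq : d x q < a.
  by rewrite (le_lt_trans xq)// invf_plt ?posrE//; exact: truncnS_gt.
exists k => //; exists (index q (E k)) => //=; rewrite nth_index//.
have := dist_triangle dM x q y; rewrite (dist_sym dM q x).
by rewrite /a in xq; lra.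
Qed.

Lemma measurable_dn n : measurable_fun setT (fun z : X * X => dn d f n z.1 z.2).
Proof.
apply: measurable_fun_ltP => r.
have [r0|r0] := leP r 0.
  rewrite (_ : mkset _ = set0)//; apply/seteqP; split => // z /=.
  by have := dn_ge0 d f n z.1 z.2; lra.
rewrite (_ : mkset _ = \bigcap_(i in [set i | (i < n)%N])
   [set z : X * X | d (iter i f z.1) (iter i f z.2) < r]).
  apply: bigcap_measurableType => // i _; apply: measurable_fun_lt.
  have mi : measurable_fun setT (fun z : X * X => (iter i f z.1, iter i f z.2)).
    apply/measurable_fun_pairP; split.
      exact: (measurableT_comp (iter_measurable i) measurable_fst).
    exact: (measurableT_comp (iter_measurable i) measurable_snd).
  exact: (measurableT_comp measurable_dist mi).
apply/seteqP; split => [z zr i /= ni|z H /=].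
  by apply: le_lt_trans zr; exact: dist_le_dn.
by apply/bigmax_ltP; split => // i _; apply: H => /=.
Qed.

Lemma measurable_point x : measurable [set x : X].
Proof.
rewrite -[X in measurable X]setCK; apply/measurableC/dopen_measurable.
move=> y /= /eqP yx; exists (d y x); split; last by move=> z /= + zx; rewrite zx ltxx.
rewrite lt_neqAle dist_ge0// andbT; apply: contra_neq yx => yx.
by have [H _ _] := dM; apply/H.
Qed.

End Measurability.

(** Finite combinations of Dirac masses, with repeated atoms allowed; they provide the periodic
    measures, the quantized measures and the transport plans. *)
Lemma discrete_probability {R : realType} {disp : measure_display}
  {T : measurableType disp} (I : finType) (c : I -> R) (z : I -> T) :
  (forall i, 0 <= c i) -> \sum_i c i = 1 ->
  exists P : probability T R,
    (forall A, P A = (\sum_i c i * \1_A (z i))%:E) /\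
    forall g : T -> R, measurable_fun setT g -> (forall x, 0 <= g x) ->
      (\int[P]_x (g x)%:E = (\sum_i c i * g (z i))%:E)%E.
Proof.
move=> c0 c1.
have [i0 _] : exists i0 : I, True.
  case: (pickP (xpredT : pred I)) => [i0 _|I0]; first by exists i0.
  by move: c1; rewrite big_pred0// => /eqP; rewrite eq_sym oner_eq0.
have sumE (F : I -> R) : \sum_i F i = \sum_(k < #|I|) F (nth i0 (enum I) k).
  have -> : \sum_i F i = \sum_(i <- enum I) F i by rewrite big_enum.
  by rewrite (big_nth i0) big_mkord cardE.
pose m_ k : {measure set T -> \bar R} :=
  mscale (NngNum (c0 (nth i0 (enum I) k))) \d_(z (nth i0 (enum I) k)).
pose mu : {measure set T -> \bar R} := msum m_ #|I|.
have muE A : mu A = (\sum_i c i * \1_A (z i))%:E.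
  rewrite sumE -sumEFin; apply: eq_bigr => k _.
  by rewrite /m_ /= /mscale /= diracE indicE -EFinM.
have mu1 : mu setT = 1%E.
  by rewrite muE; under eq_bigr do rewrite indicT mulr1; rewrite c1.
pose P : probability T R := HB.pack (msum m_ #|I|)
  (Measure_isProbability.Build _ _ _ (msum m_ #|I|) mu1).
exists P; split; first exact: muE.
move=> g mg g0; rewrite sumE -sumEFin.
rewrite [LHS](ge0_integral_measure_sum m_)//; last 2 first.
- by move=> x _; rewrite lee_fin.
- exact/measurable_EFinP.
apply: eq_bigr => k _; rewrite ge0_integral_mscale//; last 2 first.
- exact/measurable_EFinP.
- by move=> x _; rewrite lee_fin.
rewrite integral_dirac//; last exact/measurable_EFinP.
by rewrite diracT mul1e.
Qed.

(** Invariance is a cyclic shift of the sum; ergodicity holds because the indicator of an invariant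
    set is constant along the orbit. *)
Lemma periodic_measure {R : realType} {disp : measure_display}
  {X : measurableType disp} (f : X -> X) T z :
  (0 < T)%N -> iter T f z = z -> exists mu : probability X R, Mper f mu /\
    forall A, mu A = (T%:R^-1 * \sum_(i < T) \1_A (iter i f z))%:E.
Proof.
move=> T0 zT; have TN0 : T%:R != 0 :> R by rewrite pnatr_eq0 -lt0n.
have [||mu [muE _]] := @discrete_probability R _ X 'I_T (fun=> T%:R^-1)
  (fun i => iter i f z).
- by move=> i; rewrite invr_ge0.
- by rewrite sumr_const card_ord -[LHS]mulr_natr mulVf.
have {}muE A : mu A = (T%:R^-1 * \sum_(i < T) \1_A (iter i f z))%:E.
  by rewrite muE mulr_sumr.
exists mu; split; last exact: muE.
have indicf (A : set X) x : \1_(f @^-1` A) x = \1_A (f x) :> R.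
  by rewrite !indicE; congr (_%:R); apply/idP/idP; rewrite !inE.
split; last split.
- move=> A _; rewrite !muE; congr ((_ * _)%:E).
  under eq_bigr do rewrite indicf -iterS.
  case: T T0 zT {TN0 muE} => // T _ zT.
  by rewrite big_ord_recr zT [RHS]big_ord_recl addrC.
- move=> A _ fA; rewrite muE.
  have iA i : \1_A (iter i f z) = \1_A z :> R.
    by elim: i => // i <-; rewrite iterS -indicf fA.
  under eq_bigr do rewrite iA.
  rewrite sumr_const card_ord -[X in (_ * X)%:E]mulr_natr mulrC mulfK// indicE.
  by case: (_ \in _); [right|left].
exists z; split; first by exists T.
rewrite muE (eq_bigr (fun=> 1)); last first.
  by move=> i _; rewrite indicE mem_set//; exists i.
by rewrite sumr_const card_ord mulVf.
Qed.

(** * Transport estimates between periodic measures *)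

Section Transport.
Context {R : realType} {disp : measure_display} {X : measurableType disp}.
Variables (d : X -> X -> R) (f : X -> X).
Hypotheses (dM : is_metric d) (dK : dcompact d) (dB : borel_structure d).
Hypothesis (fC : dcontinuous d f).

(** Markov's inequality for a nearly optimal plan; the factor [2] pays for an infimum that need not
    be attained. *)
Lemma coupling_markov (mu nu : probability X R) n (e s : R) :
  0 < e -> (W1n d f n mu nu <= e%:E)%E -> 0 < s ->
  exists2 pi, coupling mu nu pi & forall A, measurable A ->
    (forall z, A z -> s <= dn d f n z.1 z.2) -> (s%:E * pi A <= (2 * e)%:E)%E.
Proof.
move=> e0 We s0.
have : (W1n d f n mu nu < (2 * e)%:E)%E by rewrite (le_lt_trans We)// lte_fin; lra.
move=> /ereal_inf_lt[_ [pi cpi <-] pie]; exists pi => // A mA As.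
apply: le_trans (ltW pie).
have mdn := measurable_dn dM dK dB fC n.
rewrite -[X in pi X]setIT -integral_indic// -ge0_integralZl//; last 2 first.
- by apply/measurable_EFinP; exact: measurable_indic.
- by rewrite lee_fin ltW.
apply: ge0_le_integral => //.
- by move=> z _; rewrite -EFinM lee_fin mulr_ge0// ltW.
- apply: measurable_funeM; apply/measurable_EFinP; exact: measurable_indic.
- exact/measurable_EFinP.
move=> z _; rewrite -EFinM lee_fin indicE.
by case: (boolP (z \in A)) => [/set_mem/As|_]; rewrite ?mulr1// mulr0 dn_ge0.
Qed.

(* No gluing of couplings is needed: the atoms of [mub] far from [za]'s orbit form
   a set [F] which both plans can only empty at a definite cost, through the
   intermediate set [U]. *)
Lemma common_approximation n T (za zb : X) (mua mub nu : probability X R) (e s : R) :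
  (0 < T)%N -> 0 < e -> 0 < s ->
  (forall A, mua A = (T%:R^-1 * \sum_(i < T) \1_A (iter i f za))%:E) ->
  (forall A, mub A = (T%:R^-1 * \sum_(i < T) \1_A (iter i f zb))%:E) ->
  (W1n d f n mua nu <= e%:E)%E -> (W1n d f n mub nu <= e%:E)%E ->
  s * #|[pred t : 'I_T | [forall t' : 'I_T,
     2 * s < dn d f n (iter t f zb) (iter t' f za)]]|%:R <= 4 * e * T%:R.
Proof.
move=> T0 e0 s0 muaE mubE Wa Wb.
pose S r := [set x | forall t' : 'I_T, r < dn d f n x (iter t' f za)].
have mS r : measurable (S r).
  rewrite (_ : S r = \bigcap_(t' in [set: 'I_T]) [set x | r < dn d f n x (iter t' f za)]).
    apply: fin_bigcap_measurable => // t _.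
    rewrite -[X in measurable X]setCK; apply: measurableC.
    rewrite (_ : ~` _ = \bigcap_(k in [set: nat])
        [set x | dn d f n x (iter t f za) < r + k.+1%:R^-1]).
      apply: bigcapT_measurable => k; apply: measurable_fun_lt.
      have mp : measurable_fun setT (fun x : X => (x, iter t f za)).
        by apply/measurable_fun_pairP; split; [exact: measurable_id|exact: measurable_cst].
      exact: (measurableT_comp (measurable_dn dM dK dB fC n) mp).
    apply/seteqP; split => x /=.
      move=> /negP; rewrite -leNgt => xr k _; apply: (le_lt_trans xr).
      by rewrite ltrDl invr_gt0.
    move=> H; apply/negP; rewrite -leNgt; apply/ler_addgt0Pl => a a0; rewrite addrC.
    have := H (Num.truncn a^-1) I => /ltW/le_trans; apply; rewrite lerD2l.
    by rewrite invf_ple ?posrE// ltW// truncnS_gt.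
  by apply/seteqP; split => x H t'; [move=> _; exact: (H t')|exact: (H t' I)].
have [pia cpia Ma] := coupling_markov e0 Wa s0.
have [pib cpib Mb] := coupling_markov e0 Wb s0.
(* [S r] collects the points farther than [r] from all windows of the orbit of [za]; leaving [V] for
   [U], or [U] for [F], takes a distance of at least [s]. *)
pose F := S (2 * s); pose U := S s; pose V := S 0.
have mF : measurable F := mS _; have mU : measurable U := mS _.
have mV : measurable V := mS _.
have T0R : 0 < T%:R :> R by rewrite ltr0n.
have muaV : mua V = 0%E.
  rewrite muaE big1 ?mulr0// => i _; rewrite indicE memNset// => /(_ i).
  by rewrite dn_refl// ltxx.
(* [mua] does not charge [V], so all the mass that [pia] brings into [U] travels at least [s]. *)
have nuU : (s%:E * nu U <= (2 * e)%:E)%E.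
  have [_ <-] := cpia _ (mS s).
  have : (pia (setT `*` U) <= pia (~` V `*` U) + pia (V `*` setT))%E.
    apply: le_trans (measureU2 _ _ _); try by apply: measurableX => //; exact: measurableC.
    apply: le_measure; rewrite ?inE; first exact: measurableX.
      by apply: measurableU; apply: measurableX => //; exact: measurableC.
    move=> [x y] [_ /= Uy]; have [Vx|nVx] := pselect (V x); first by right.
    by left.
  have [-> _] := cpia _ (mS 0); rewrite muaV adde0 => H.
  apply: le_trans (Ma (~` V `*` U) _ _).
  - by rewrite lee_pmul2l.
  - by apply: measurableX => //; exact: measurableC.
  move=> [x y] [/= nVx Uy].
  have [t xt] : exists t : 'I_T, dn d f n x (iter t f za) <= 0.
    by apply: contrapT => H'; apply: nVx => t; rewrite ltNge; apply/negP => ?;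
      apply: H'; exists t.
  have := Uy t; have := dn_triangle f dM n x y (iter t f za).
  by rewrite (dn_sym f dM n y x); lra.
(* The mass of [F] either travels at least [s] out of [U] or ends in [U], where [nu] is small. *)
have mubF : (s%:E * mub F <= (4 * e)%:E)%E.
  have [<- _] := cpib _ (mS (2 * s)).
  have : (pib (F `*` setT) <= pib (F `*` ~` U) + pib (setT `*` U))%E.
    apply: le_trans (measureU2 _ _ _); try by apply: measurableX => //; exact: measurableC.
    apply: le_measure; rewrite ?inE; first exact: measurableX.
      by apply: measurableU; apply: measurableX => //; exact: measurableC.
    move=> [x y] [/= Fx _]; have [Uy|nUy] := pselect (U y); first by right.
    by left.
  have [_ ->] := cpib _ (mS s) => H.
  apply: (@le_trans _ _ (s%:E * (pib (F `*` ~` U) + nu U))%E).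
    by rewrite lee_pmul2l.
  rewrite ge0_muleDr//.
  rewrite (_ : 4 * e = 2 * e + 2 * e); last lra.
  rewrite EFinD leeD//; apply: Mb.
    by apply: measurableX => //; exact: measurableC.
  move=> [x y] [/= Fx nUy].
  have [t yt] : exists t : 'I_T, dn d f n y (iter t f za) <= s.
    by apply: contrapT => H'; apply: nUy => t; rewrite ltNge; apply/negP => ?;
      apply: H'; exists t.
  by have := Fx t; have := dn_triangle f dM n y x (iter t f za); lra.
move: mubF; rewrite mubE -EFinM lee_fin mulrCA ler_pdivrMl// (mulrC T%:R).
apply: le_trans; rewrite ler_pM2l// -sum1_card natr_sum big_mkcond /=.
apply: ler_sum => t _; rewrite indicE inE.
case: ifPn => [/forallP H|_]; last by rewrite ler0n.
by rewrite mem_set.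
Qed.

End Transport.

(** * Quantization *)

Section Quantization.
Context {R : realType} {disp : measure_display} {X : measurableType disp}.
Variables (d : X -> X -> R) (f : X -> X).
Hypotheses (dM : is_metric d) (dK : dcompact d) (dB : borel_structure d).
Hypothesis (fC : dcontinuous d f).

Lemma finitely_supported (mu : probability X R) (O : seq X) : uniq O ->
  mu [set` O] = 1%E -> forall A, measurable A ->
  mu A = (\sum_(i < size O) fine (mu [set tnth (in_tuple O) i]) *
            \1_A (tnth (in_tuple O) i))%:E.
Proof.
move=> uO mO A mA; pose p i := tnth (in_tuple O) i.
have ms1 (x : X) : measurable [set x] by exact: (measurable_point dM dB).
have OE : [set` O] = \bigcup_(i in [set: 'I_(size O)]) [set p i].
  apply/seteqP; split => x /=.
    by move=> /(tnthP (in_tuple O))[i ->]; exists i.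
  by move=> [i _ ->]; exact: (mem_tnth i (in_tuple O)).
have mO' : measurable [set` O].
  by rewrite OE; apply: fin_bigcup_measurable => // i _; exact: ms1.
have mOC : mu (~` [set` O]) = 0%E by rewrite probability_setC// mO subee.
have -> : mu A = mu (\big[setU/set0]_(i < size O) (A `&` [set p i])).
  apply/eqP; rewrite eq_le; apply/andP; split; last first.
    apply: le_measure; rewrite ?inE//.
      by apply: bigsetU_measurable => i _; apply: measurableI.
    by rewrite -bigcup_seq => x [i _ []].
  have mB : measurable (\big[setU/set0]_(i < size O) (A `&` [set p i])).
    by apply: bigsetU_measurable => i _; apply: measurableI.
  apply: (@le_trans _ _ (mu (\big[setU/set0]_(i < size O) (A `&` [set p i])) +
      mu (~` [set` O]))%E); last by rewrite mOC adde0.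
  apply: le_trans (measureU2 _ _ _) => //; last exact: measurableC.
  apply: le_measure; rewrite ?inE//.
    by apply: measurableU => //; exact: measurableC.
  move=> x Ax; have [xO|xO] := pselect ([set` O] x); last by right.
  by left; move: xO; rewrite OE => -[i _ xi]; rewrite -bigcup_seq; exists i => //=;
    rewrite mem_index_enum.
rewrite measure_semi_additive_ord//=.
- rewrite -sumEFin; apply: eq_bigr => i _; rewrite indicE.
  have [Ai|nAi] := boolP (p i \in A).
    rewrite mulr1 fineK ?fin_num_measure//; congr (mu _).
    by apply/seteqP; split => [x []//|x /= ->]; split => //; exact: set_mem.
  rewrite mulr0 (_ : _ `&` _ = set0) ?measure0//.
  apply/seteqP; split => // x [Ax /= xi]; move: nAi; rewrite -xi mem_set//.
- by move=> i; exact: measurableI.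
- move=> i j _ _ [x [[_ /= xi] [_ /= xj]]]; apply/val_inj/eqP => /=.
  have := xi; rewrite xj /p !(tnth_nth point) /= => /eqP.
  by rewrite nth_uniq// eq_sym.
- by apply: bigsetU_measurable => i _; apply: measurableI.
Qed.

Lemma periodic_orbitE (x : X) p : (0 < p)%N -> iter p f x = x ->
  Defs.orbit f x = [set` undup (mkseq (fun i => iter i f x) p)].
Proof.
move=> p0 px; apply/seteqP; split => y /=.
  move=> [i _ <-]; rewrite mem_undup; apply/mapP; exists (i %% p)%N.
    by rewrite mem_iota ltn_mod.
  rewrite {1}(divn_eq i p) addnC iterD; congr (iter _ f _).
  by elim: (i %/ p)%N => // k IH; rewrite mulSn addnC iterD px.
by rewrite mem_undup => /mapP[i _ ->]; exists i.
Qed.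

(* The weight [w k] of the cell [tau = k] is rounded down to [a k / M]; the plan
   sends the fraction [rho k] of the cell to [y k] and the excess to [y ord0]. *)
Lemma quantized_approximation (mu : probability X R) n (e D : R) K M (y : 'I_K.+1 -> X)
    (s : nat) (m : 'I_s -> R) (p : 'I_s -> X) (tau : 'I_s -> 'I_K.+1) :
  0 < e -> (0 < M)%N -> K.+1%:R * D <= e * M%:R ->
  (forall x y, dn d f n x y <= D) ->
  (forall i, 0 <= m i) -> \sum_i m i = 1 ->
  (forall A, measurable A -> mu A = (\sum_i m i * \1_A (p i))%:E) ->
  (forall i, dn d f n (p i) (y (tau i)) <= e) ->
  exists a : {ffun 'I_K.+1 -> 'I_M.+1}, (\sum_k a k <= M)%N /\
  forall nu : probability X R,
    (forall A, nu A = (\sum_k (a k)%:R / M%:R * \1_A (y k) +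
       (1 - \sum_k (a k)%:R / M%:R) * \1_A (y ord0))%:E) ->
    (W1n d f n mu nu <= (2 * e)%:E)%E.
Proof.
move=> e0 M0 KDM dD m0 m1 muE ptau.
have M0R : 0 < M%:R :> R by rewrite ltr0n.
have D0 : 0 <= D by exact: le_trans (dn_ge0 d f n point point) (dD _ _).
pose w k := \sum_(i | tau i == k) m i.
have regroup (g : 'I_K.+1 -> R) : \sum_i m i * g (tau i) = \sum_k w k * g k.
  rewrite (partition_big tau xpredT)//=; apply: eq_bigr => k _.
  by rewrite mulr_suml; apply: eq_bigr => i /eqP->.
have w0 k : 0 <= w k by apply: sumr_ge0.
have w1 : \sum_k w k = 1.
  have := regroup (fun=> 1); rewrite (eq_bigr m); last by move=> *; rewrite mulr1.
  by rewrite m1 => ->; apply: eq_bigr => k _; rewrite mulr1.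
have wle1 k : w k <= 1 by rewrite -w1 (bigD1 k)//= lerDl sumr_ge0.
pose b k := Num.truncn (M%:R * w k).
have bMw k : (b k)%:R <= M%:R * w k by rewrite truncn_le mulr_ge0// ltW.
have bM k : (b k < M.+1)%N.
  rewrite ltnS -(ler_nat R) (le_trans (bMw k))//.
  by rewrite -[leRHS]mulr1 ler_pM2l.
have bw k : (b k)%:R / M%:R <= w k.
  by rewrite ler_pdivrMr// mulrC.
have wb k : w k - (b k)%:R / M%:R <= M%:R^-1.
  rewrite lerBlDl -[X in _ + X]mul1r -mulrDl ler_pdivlMr// mulrC natr1.
  by rewrite ltW// truncnS_gt.
pose a : {ffun 'I_K.+1 -> 'I_M.+1} := [ffun k => Ordinal (bM k)].
have aE k : a k = b k :> nat by rewrite ffunE.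
exists a; split.
  rewrite -(ler_nat R) natr_sum -[leRHS]mulr1 -ler_pdivrMl// mulr_sumr -[leRHS]w1.
  by apply: ler_sum => k _; rewrite aE mulrC.
move=> nu nuE.
(* On a cell of weight [0] the convention for inverses gives [rho k = 0], in accordance with its
   rounded weight [0]. *)
pose rho k := (b k)%:R / M%:R / w k.
have rho0 k : 0 <= rho k by rewrite /rho !divr_ge0.
have wrho k : w k * rho k = (b k)%:R / M%:R.
  have [wk|wk] := eqVneq (w k) 0; last by rewrite /rho mulrCA mulfV// mulr1.
  rewrite wk mul0r; apply/eqP; rewrite eq_le -{2}wk bw andbT.
  by rewrite divr_ge0// ltW.
have rho1 k : rho k <= 1.
  have [wk|wk] := eqVneq (w k) 0; first by rewrite /rho wk invr0 mulr0.
  by rewrite /rho ler_pdivrMr ?mul1r// lt_neqAle eq_sym wk w0.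
pose c (ib : 'I_s * bool) := m ib.1 * (if ib.2 then rho (tau ib.1) else 1 - rho (tau ib.1)).
pose z (ib : 'I_s * bool) := (p ib.1, if ib.2 then y (tau ib.1) else y ord0).
have sumE (F : 'I_s * bool -> R) : \sum_ib c ib * F ib =
    \sum_i m i * (rho (tau i) * F (i, true) + (1 - rho (tau i)) * F (i, false)).
  rewrite (eq_bigr (fun ib => c (ib.1, ib.2) * F (ib.1, ib.2))); last by case.
  rewrite -(pair_bigA _ (fun i b => c (i, b) * F (i, b))) /=.
  by apply: eq_bigr => i _; rewrite big_bool /c /=; ring.
have [||pi [piE piI]] := @discrete_probability R _ (X * X)%type ('I_s * bool)%type c z.
- by move=> [i [|]]; rewrite /c /= mulr_ge0// subr_ge0.
- rewrite -m1 (eq_bigr (fun ib => c ib * 1)); last by move=> *; rewrite mulr1.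
  by rewrite sumE; apply: eq_bigr => i _; ring.
have indicX (A B : set X) u v : \1_(A `*` B) (u, v) = \1_A u * \1_B v :> R.
  rewrite !indicE -natrM mulnb; congr (nat_of_bool _)%:R.
  by apply/idP/andP; rewrite !inE.
have cpi : coupling mu nu pi.
  move=> A mA; rewrite !piE !sumE muE// nuE; split; congr (_%:E).
    by apply: eq_bigr => i _; rewrite /z /= !indicX !indicT /=; ring.
  under eq_bigr do rewrite /z /= !indicX !indicT /= !mul1r.
  rewrite (regroup (fun k => rho k * \1_A (y k) + (1 - rho k) * \1_A (y ord0))).
  rewrite -[X in (X - _)]w1 -sumrB mulr_suml -big_split/=; apply: eq_bigr => k _.
  by rewrite aE -wrho; ring.
apply: le_trans (ereal_inf_lbound _) _; first by exists pi.
rewrite (piI (fun z => dn d f n z.1 z.2)); last 2 first.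
- exact: (measurable_dn dM dK dB fC n).
- by move=> *; exact: dn_ge0.
rewrite lee_fin sumE /z /=.
apply: (@le_trans _ _ (\sum_i m i * (e + (1 - rho (tau i)) * D))).
  apply: ler_sum => i _; rewrite ler_wpM2l// lerD//.
    by rewrite -[leRHS]mul1r ler_pM// dn_ge0.
  by rewrite ler_wpM2l// subr_ge0.
rewrite (regroup (fun k => e + (1 - rho k) * D)).
(* Each cell has an excess of at most [1 / M], moved by at most [D]; over [K.+1] cells this adds up
   to at most [e]. *)
apply: (@le_trans _ _ (\sum_k (w k * e + M%:R^-1 * D))).
  apply: ler_sum => k _; rewrite mulrDr lerD2l mulrA ler_wpM2r//.
  by rewrite mulrBr mulr1 wrho.
rewrite big_split/= -mulr_suml w1 mul1r sumr_const card_ord -[X in _ + X]mulr_natr.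
suff : M%:R^-1 * D * K.+1%:R <= e by lra.
by rewrite -mulrA ler_pdivrMl// mulrC (mulrC M%:R).
Qed.

(** The list consists of the measures on the net with weights [a k / M], the missing mass being put
    at [y ord0], one for each function [a]. *)
Lemma NM_le n (e D : R) (E : seq X) M : 0 < e -> (0 < M)%N ->
  (forall x y, dn d f n x y <= D) -> (size E)%:R * D <= e * M%:R ->
  (forall x, exists2 y, y \in E & dn d f n x y <= e) ->
  exists L : seq (probability X R), size L = (M.+1 ^ size E)%N /\
    forall mu, Mper f mu -> exists2 nu, nu \in L & (W1n d f n mu nu <= (2 * e)%:E)%E.
Proof.
move=> e0 M0 dD; case: E => [|y0 E0] EDM Espan; first by have [y] := Espan point.
pose E := in_tuple (y0 :: E0); pose K := size E0.
pose y (k : 'I_K.+1) := tnth E k.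
have M0R : 0 < M%:R :> R by rewrite ltr0n.
have Hnu (a : {ffun 'I_K.+1 -> 'I_M.+1}) : exists nu : probability X R,
    (\sum_k a k <= M)%N -> forall A, nu A = (\sum_k (a k)%:R / M%:R * \1_A (y k) +
       (1 - \sum_k (a k)%:R / M%:R) * \1_A (y ord0))%:E.
  (* Functions with total above [M] define no probability; they get a dummy value, which keeps the
     count a plain power. *)
  have [aM|] := leqP (\sum_k a k) M; last by exists (\d_point).
  pose c k := (a k)%:R / M%:R + (if k == ord0 then 1 - \sum_k (a k)%:R / M%:R else 0) : R.
  have csum (g : 'I_K.+1 -> R) : \sum_k c k * g k = \sum_k (a k)%:R / M%:R * g k +
       (1 - \sum_k (a k)%:R / M%:R) * g ord0.
    under eq_bigr do rewrite /c mulrDl.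
    rewrite big_split/=; congr (_ + _); rewrite (bigD1 ord0)//= [X in _ + X = _]big1 ?addr0//.
    by move=> k /negPf->; rewrite mul0r.
  have [||nu [nuE _]] := @discrete_probability R _ X 'I_K.+1 c y.
  - move=> k; rewrite /c addr_ge0// ?divr_ge0//; case: ifP => // _.
    by rewrite subr_ge0 -mulr_suml ler_pdivrMr// mul1r -natr_sum ler_nat.
  - rewrite (eq_bigr (fun k => c k * 1)); last by move=> *; rewrite mulr1.
    by rewrite csum; under eq_bigr do rewrite mulr1; rewrite mulr1 addrC subrK.
  by exists nu => _ A; rewrite nuE csum.
have {Hnu}[nu nuE] := choice Hnu.
exists (map nu (enum {ffun 'I_K.+1 -> 'I_M.+1})); split.
  by rewrite size_map -cardE card_ffun !card_ord.
move=> mu [_ [_ [x [[q [q0 qx]] mux]]]].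
rewrite (periodic_orbitE q0 qx) in mux.
set O := undup _ in mux; have uO : uniq O by exact: undup_uniq.
have muE := finitely_supported uO mux.
have Htau i : exists k, dn d f n (tnth (in_tuple O) i) (y k) <= e.
  have [v /(tnthP E)[k ->]] := Espan (tnth (in_tuple O) i).
  by exists k.
have {Htau}[tau Htau] := choice Htau.
have [||a [aM Ha]] := quantized_approximation e0 M0 EDM dD _ _ muE Htau.
- by move=> i; rewrite fine_ge0.
- apply: EFin_inj; rewrite -(probability_setT mu) muE//; congr (_%:E).
  by apply: eq_bigr => i _; rewrite indicT mulr1.
exists (nu a); first by apply: map_f; rewrite mem_enum.
by apply: Ha; exact: nuE.
Qed.

End Quantization.

(** * Counting periodic measures *)

Section Counting.
Local Open Scope nat_scope.

(** The times below [P * n] split into [n] residue classes, so some class contains at most the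
    average number of bad times. *)
Lemma good_offset n P T (bad : pred nat) : 0 < n -> P * n <= T ->
  exists o : 'I_n, (\sum_(j < P) bad (j * n + o)) * n <= \sum_(t < T) bad t.
Proof.
move=> n0 PnT; apply: contrapT => H.
have {}H (o : 'I_n) : \sum_(t < T) bad t < (\sum_(j < P) bad (j * n + o)) * n.
  by rewrite ltnNge; apply/negP => ?; apply: H; exists o.
have tile : \sum_(o < n) \sum_(j < P) bad (j * n + o) <= \sum_(t < T) bad t.
  apply: (@leq_trans (\sum_(t < P * n) bad t)).
    elim: P {PnT H} => [|P IH]; first by rewrite big1// => i _; rewrite big_ord0.
    under eq_bigr do rewrite big_ord_recr.
    by rewrite big_split/= mulSnr big_split_ord/= leq_add2r.
  rewrite -(big_mkord xpredT (fun t => nat_of_bool (bad t))).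
  rewrite -[leqRHS](big_mkord xpredT (fun t => nat_of_bool (bad t))).
  by rewrite [leqRHS](big_cat_nat (leq0n _) PnT) leq_addr.
have : \sum_(o < n) (\sum_(t < T) bad t).+1 <= \sum_(o < n) (\sum_(j < P) bad (j * n + o)) * n.
  by apply: leq_sum => o _; exact: H.
rewrite sum_nat_const card_ord -big_distrl /= mulnC leq_pmul2r//.
by move=> /leq_trans/(_ tile); rewrite ltnn.
Qed.

Section Codes.
Variables (P K T n B : nat).

(** Position [j] is a hole when window [j - 1] or [j] is missing. For the last index [inord i.+1]
    falls back to [ord0], which is a hole anyway. *)
Definition holes (h : {ffun 'I_P.+1 -> option 'I_T}) : {set 'I_P.+1} :=
  let S := finset (fun j => h j == None) in
  (ord0 |: (S :|: (fun i : 'I_P.+1 => inord i.+1) @: S))%SET.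

Lemma card_holes h : #|holes h| <= (2 * \sum_j (h j == None)).+1.
Proof.
rewrite /holes; set S := finset _.
have -> : \sum_j (h j == None) = #|S|.
  by rewrite -sum1_card [RHS]big_mkcond /=; apply: eq_bigr => j _; rewrite inE; case: eqP.
rewrite cardsU1 -[leqRHS]add1n leq_add//; first by case: (_ \notin _).
rewrite (leq_trans (leq_card_setU _ _).1)// mul2n -addnn leq_add2l.
exact: leq_imset_card.
Qed.

Lemma notin_holes h j : j \notin holes h ->
  exists i : 'I_P.+1, [/\ j = i.+1 :> nat, h i != None & h j != None].
Proof.
rewrite !inE !negb_or => /and3P[j0 hj jS].
have jE : j.-1.+1 = j by rewrite prednK// lt0n.
have jP : j.-1 < P.+1 by rewrite (leq_ltn_trans (leq_pred _)).
exists (Ordinal jP); split; [by rewrite /= jE| |by []].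
apply: contra jS => hi; apply/imsetP; exists (Ordinal jP); first by rewrite inE.
by apply: val_inj => /=; rewrite jE inordK.
Qed.

(** A word is recovered from its offset, its window positions and its letters at the holes, which
    gives the three factors. *)
Lemma card_coded (W : {set {ffun 'I_P.+1 -> 'I_K.+1}})
    (o : {ffun 'I_P.+1 -> 'I_K.+1} -> 'I_n)
    (g : {ffun 'I_P.+1 -> 'I_K.+1} -> {ffun 'I_P.+1 -> option 'I_T}) :
  {in W, forall b, #|holes (g b)| <= B} ->
  {in W &, forall b b', o b = o b' -> g b = g b' ->
     forall j, j \notin holes (g b) -> b j = b' j} ->
  #|W| <= n * T.+1 ^ P.+1 * K.+1 ^ B.
Proof.
move=> WB Winj.
(* The letters at the holes, padded with [ord0] to length [B]. *)
pose r (b : {ffun 'I_P.+1 -> 'I_K.+1}) :=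
  [ffun i : 'I_B => nth ord0 (map b (enum (holes (g b)))) i].
pose code b := (o b, g b, r b).
have code_inj : {in W &, injective code}.
  move=> b b' bW b'W [ob gb rb]; apply/ffunP => j.
  have [jh|] := boolP (j \in holes (g b)); last exact: Winj.
  have jE : j \in enum (holes (g b)) by rewrite mem_enum.
  have jB : index j (enum (holes (g b))) < B.
    by apply: leq_trans (WB _ bW); rewrite cardE index_mem.
  move/ffunP : rb => /(_ (Ordinal jB)); rewrite !ffunE /= -gb.
  by rewrite !(nth_map ord0) ?index_mem// nth_index.
rewrite -(card_in_imset code_inj); apply: leq_trans (max_card _) _.
by rewrite !card_prod !card_ffun card_option !card_ord.
Qed.

End Codes.
End Counting.

(** * Counting words through their periodic measures *)

Section ManyPeriodicMeasures.
Context {R : realType} {disp : measure_display} {X : measurableType disp}.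
Variables (d : X -> X -> R) (f : X -> X).
Hypotheses (dM : is_metric d) (dK : dcompact d) (dB : borel_structure d).
Hypothesis (fC : dcontinuous d f).

Variables (e e' s : R) (N Q m P K B : nat).
Let n := (m + N)%N.
Let T := (P.+1 * n + Q)%N.
Hypotheses (e0 : 0 < e) (se : 8 * s = e) (e'0 : 0 < e') (n0 : (0 < n)%N).
Hypothesis tracing : forall x : nat -> X, exists z, iter T f z = z /\
  forall j i, (j < P.+1)%N -> (i < m)%N ->
    d (iter (j * n + i) f z) (iter i f (x j)) <= s.
Hypothesis Kspan : (K.+1 <= span_num d f m e)%N.
Hypothesis holesB : forall c : nat, s * (c * n)%:R <= 4 * e' * T%:R -> ((2 * c).+1 <= B)%N.
Variable L : seq (probability X R).
Hypothesis Lcover : forall mu, Mper f mu ->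
  exists2 nu, nu \in L & (W1n d f n mu nu <= e'%:E)%E.

(* The windows [[j n + o, (j + 1) n + o)] tile time, so the letter in position [j]
   is recovered from the windows [j - 1] and [j]. *)
Lemma window_determines (y0 y1 u u' v v' : X) (o : nat) : (o < n)%N ->
  dn d f n (iter o f u) y0 <= 2 * s -> dn d f n (iter o f u') y0 <= 2 * s ->
  dn d f n (iter (n + o) f u) y1 <= 2 * s -> dn d f n (iter (n + o) f u') y1 <= 2 * s ->
  (forall i, (i < m)%N -> d (iter (n + i) f u) (iter i f v) <= s) ->
  (forall i, (i < m)%N -> d (iter (n + i) f u') (iter i f v') <= s) ->
  dn d f m v v' <= e.
Proof.
have s0 : 0 <= 2 * s by have := e0; have := se; lra.
move=> on /(dn_leP _ _ _ _ _ s0) a /(dn_leP _ _ _ _ _ s0) a'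
  /(dn_leP _ _ _ _ _ s0) b /(dn_leP _ _ _ _ _ s0) b' uv u'v'.
apply/dn_leP => [|i im]; first exact: ltW.
have im' : (i < n)%N by rewrite /n; lia.
(* The two windows cost [4 * s] and the two shadowings [2 * s], within [e = 8 * s]. Time [n + i]
   lies in the second window if [o <= i], and in the first otherwise. *)
suff : d (iter (n + i) f u) (iter (n + i) f u') <= 4 * s.
  move=> H; have := dist_triangle dM (iter (n + i) f u) (iter i f v) (iter i f v').
  have := dist_triangle dM (iter (n + i) f u') (iter (n + i) f u) (iter i f v').
  have := e0; have := se; have := uv i im; have := u'v' i im.
  rewrite (dist_sym dM (iter i f v) (iter (n + i) f u)).
  by lra.
have [oi|io] := leqP o i.
  have ioE : (n + i = (i - o) + (n + o))%N by lia.
  have io' : (i - o < n)%N by lia.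
  have := b _ io'; have := b' _ io'; rewrite -!iterD -ioE.
  have := dist_triangle dM (iter (i - o) f y1) (iter (n + i) f u) (iter (n + i) f u').
  by rewrite (dist_sym dM (iter (i - o) f y1)); lra.
have ioE : (n + i = (n + i - o) + o)%N by lia.
have io' : (n + i - o < n)%N by lia.
have := a _ io'; have := a' _ io'; rewrite -!iterD -ioE.
have := dist_triangle dM (iter (n + i - o) f y0) (iter (n + i) f u) (iter (n + i) f u').
by rewrite (dist_sym dM (iter (n + i - o) f y0)); lra.
Qed.

(** Words are grouped by an element of [L] close to their measure. In one group, each word is coded
    relative to the orbit of a fixed word [a]; equal codes give letters within [e], hence equal
    letters by separation. *)
Lemma words_le_cover :
  (K.+1 ^ P.+1 <= size L * (n * T.+1 ^ P.+1 * K.+1 ^ B))%N.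
Proof.
have s0 : 0 < s by have := e0; have := se; lra.
have T0 : (0 < T)%N by rewrite /T; nia.
have [x xsep] := separated_seq dM Kspan.
pose word := {ffun 'I_P.+1 -> 'I_K.+1}.
have Hz (b : word) : exists z, iter T f z = z /\ forall (j : 'I_P.+1) i, (i < m)%N ->
    d (iter (j * n + i) f z) (iter i f (x (b j))) <= s.
  have [z [zT Hz]] := tracing (fun j => x (b (inord j))).
  by exists z; split => // j i im; have := Hz j i (ltn_ord j) im; rewrite inord_val.
have {Hz}[z Hz] := choice Hz.
have Hmu (b : word) := @periodic_measure R _ X f T (z b) T0 (Hz b).1.
have {Hmu}[mu Hmu] := choice Hmu.
have Hidx (b : word) : exists i : 'I_(size L),
    (W1n d f n (mu b) (tnth (in_tuple L) i) <= e'%:E)%E.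
  by have [nu /(tnthP (in_tuple L))[i ->]] := Lcover (Hmu b).1; exists i.
have {Hidx}[idx Hidx] := choice Hidx.
have -> : (K.+1 ^ P.+1 = \sum_(b : word) 1)%N.
  by rewrite sum1_card card_ffun !card_ord.
rewrite (partition_big idx xpredT)//= -[X in (X * _)%N]card_ord -sum_nat_const.
apply: leq_sum => i _; rewrite sum1dep_card.
set W := finset _.
have [->|[a aW]] := set_0Vmem W; first by rewrite cards0.
have {aW}ai : idx a = i by move: aW; rewrite inE => /eqP.
pose bad (b : word) (t : nat) := [forall t' : 'I_T,
   2 * s < dn d f n (iter t f (z b)) (iter t' f (z a))].
have Ho (b : word) : exists o : 'I_n,
    ((\sum_(j < P.+1) bad b (j * n + o)) * n <= \sum_(t < T) bad b t)%N.
  by apply: good_offset => //; rewrite /T leq_addr.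
have {Ho}[ o Ho] := choice Ho.
(* For each window of [b] at the good offset, a time at which the orbit of [z a] looks the same, or
   [None] if the window is bad. *)
pose g (b : word) : {ffun 'I_P.+1 -> option 'I_T} := [ffun j : 'I_P.+1 =>
  [pick t' : 'I_T | dn d f n (iter (j * n + o b) f (z b)) (iter t' f (z a)) <= 2 * s]].
have gN b j : (g b j == None) = bad b (j * n + o b)%N.
  rewrite ffunE; case: pickP => [t' Ht'|H] /=.
    by apply/esym/negbTE/forallPn; exists t'; rewrite -leNgt.
  by apply/esym/forallP => t'; rewrite ltNge H.
apply: (@card_coded P K T n B W o g).
- move=> b; rewrite inE => /eqP bi.
  apply: leq_trans (card_holes _) _; under eq_bigr do rewrite gN.
  apply: holesB.
  have := Hidx b; rewrite bi -ai => Wb.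
  have := common_approximation dM dK dB fC T0 e'0 s0 (Hmu a).2 (Hmu b).2 (Hidx a) Wb.
  apply: le_trans; rewrite ler_pM2l// ler_nat (leq_trans (Ho b))//.
  rewrite -sum1_card [leqRHS]big_mkcond /=; apply: leq_sum => t _.
  by rewrite inE /bad; case: ifP.
move=> b b' bW b'W oo gg j /notin_holes[j' [jj' gj' gj]].
have Hg (b1 : word) (k : 'I_P.+1) t1 : g b1 k = Some t1 ->
    dn d f n (iter (k * n + o b1) f (z b1)) (iter t1 f (z a)) <= 2 * s.
  by rewrite ffunE; case: pickP => // t' Ht' [<-].
case gj'E : (g b j') gj' => [t0|//] _; case gjE : (g b j) gj => [t1|//] _.
suff : dn d f m (x (b j)) (x (b' j)) <= e.
  move=> H; apply: val_inj; apply/eqP; case: ltngtP => // bb'.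
    by have := xsep (b j) (b' j); rewrite bb' ltn_ord => /(_ isT); lra.
  by have := xsep (b' j) (b j); rewrite bb' ltn_ord => /(_ isT); rewrite dn_sym//; lra.
have itE k u : iter (j' * n + k) f u = iter k f (iter (j' * n) f u).
  by rewrite addnC iterD.
have jE k : (j * n + k = j' * n + (n + k))%N by rewrite jj' mulSn; lia.
apply: (@window_determines (iter t0 f (z a)) (iter t1 f (z a))
  (iter (j' * n) f (z b)) (iter (j' * n) f (z b')) (x (b j)) (x (b' j)) (o b)) => //.
- by rewrite -itE; exact: Hg.
- by rewrite -itE oo; apply: Hg; rewrite -gg.
- by rewrite -itE -jE; exact: Hg.
- by rewrite -itE -jE oo; apply: Hg; rewrite -gg.
- by move=> k km; rewrite -itE -jE; exact: (Hz b).2.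
- by move=> k km; rewrite -itE -jE; exact: (Hz b').2.
Qed.

End ManyPeriodicMeasures.

(** * Limits superior and iterated logarithms *)

Section LimSup.
Context {R : realType}.
Implicit Types (u : nat -> \bar R) (c : \bar R).
Local Open Scope ereal_scope.

Lemma limn_esup_le u c n0 : (forall n, (n0 <= n)%N -> u n <= c) -> limn_esup u <= c.
Proof.
move=> H; apply: le_trans (ereal_inf_lbound _) _.
  exists [set n | (n0 <= n)%N]; last reflexivity.
  by exists n0.
by apply: ge_ereal_sup => _ [n /H + <-].
Qed.

Lemma limn_esup_ge u c : (forall n0, exists2 n, (n0 <= n)%N & c <= u n) -> c <= limn_esup u.
Proof.
move=> H; apply: le_ereal_inf_tmp => _ [V [n0 _ n0V] <-].
have [n n0n cu] := H n0; apply: le_trans cu _.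
by apply: ereal_sup_ubound; exists n => //; exact: n0V.
Qed.

Lemma limn_esup_gt u c : c < limn_esup u -> forall n0, exists2 n, (n0 <= n)%N & c < u n.
Proof.
move=> cu n0; apply: contrapT => H; move: cu; rewrite ltNge => /negP; apply.
apply: (@limn_esup_le _ _ n0) => n n0n; rewrite leNgt; apply/negP => cu.
by apply: H; exists n.
Qed.

Lemma limn_esup_lt u c : limn_esup u < c -> exists n0, forall n, (n0 <= n)%N -> u n < c.
Proof.
move=> /ereal_inf_lt[_ [V [n0 _ n0V] <-] Vc]; exists n0 => n /n0V Vn.
by apply: le_lt_trans Vc; apply: ereal_sup_ubound; exists n.
Qed.

(** The [max] with [0] absorbs the failure of [ln (ln n)] to be monotone at small [n]. *)
Lemma limn_esup_le_max u v : 0 <= limn_esup v ->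
  (forall n, u n <= Order.max 0 (v n)) -> limn_esup u <= limn_esup v.
Proof.
move=> v0 uv; apply: le_ereal_inf_tmp => _ [V VF <-].
apply: le_trans (ereal_inf_lbound _) _; first by exists V.
apply: ge_ereal_sup => _ [n Vn <-]; apply: le_trans (uv n) _.
rewrite ge_max; apply/andP; split; last by apply: ereal_sup_ubound; exists n.
by apply: le_trans v0 _; apply: ereal_inf_lbound; exists V.
Qed.

End LimSup.

Section LogLog.
Context {R : realType}.

Lemma ln_le_subr1 (x : R) : 0 < x -> ln x <= x - 1.
Proof.
by move=> x0; have := @le_ln1Dx R (x - 1); rewrite (addrC 1 (x - 1)) subrK; apply; lra.
Qed.

Lemma ln_affine_le (a b e : R) : 0 <= a -> 0 < b -> 0 < e ->
  exists n0 : nat, forall n : nat, (n0 <= n)%N -> ln (a * n%:R + b) <= e * n%:R.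
Proof.
(* Bounding [ln (x / t)] linearly gives slope [a / t], and this [t] makes it at most [e / 2]. *)
move=> a0 b0 e0; pose t := 2 * (a + 1) / e.
have t0 : 0 < t by rewrite divr_gt0//; lra.
have tE : t * e = 2 * (a + 1) by rewrite /t divfK// gt_eqF.
exists (Num.truncn (2 * (b / t + `|ln t|) / e)).+1 => n n0n.
have nR : 2 * (b / t + `|ln t|) <= e * n%:R.
  rewrite (mulrC e) -ler_pdivrMr//; apply: (le_trans (ltW (truncnS_gt _))).
  by rewrite ler_nat.
set x := a * n%:R + b.
have x0 : 0 < x by rewrite /x ltr_wpDl// mulr_ge0.
have -> : ln x = ln (x / t) + ln t.
  have := @lnM R (x / t) t; rewrite !posrE divr_gt0// t0 => /(_ isT isT) <-.
  by rewrite divfK// gt_eqF.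
have H1 := @ln_le_subr1 (x / t) (divr_gt0 x0 t0).
have H2 : ln t <= `|ln t| by exact: ler_norm.
have H3 : x / t <= e / 2 * n%:R + b / t.
  rewrite /x mulrDl lerD2r ler_pdivrMr// (mulrAC (e / 2)) ler_wpM2r//.
  have -> : e / 2 * t = t * e / 2 by ring.
  by rewrite tE; lra.
by lra.
Qed.

Lemma ln_nat_ge0 (n : nat) : 0 <= ln (n%:R : R).
Proof.
by case: n => [|n]; [rewrite ln0|rewrite ln_ge0// ler1n].
Qed.

Lemma lnln_nat_le1 (n : nat) : (n <= 1)%N -> ln (ln n%:R) = 0 :> R.
Proof. by case: n => [|[|n]]// _; rewrite ?ln1 (ln0 (lexx 0)) ?ln0. Qed.

Lemma ln_nat_gt0 (n : nat) : (1 < n)%N -> 0 < ln (n%:R : R).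
Proof. by move=> n1; rewrite ln_gt0// ltr1n. Qed.

(** A uniform lower bound disappears after division by [n], which makes [NM_growth] nonnegative. For
    [n >= 2] it comes from [ln 2 >= 1 / 2]. *)
Lemma lnln_nat_ge (n : nat) : -1 <= ln (ln n%:R) :> R.
Proof.
have [n1|n1] := leqP n 1; first by rewrite lnln_nat_le1// lerN10.
have l2 : 2^-1 <= ln 2 :> R.
  have := @ln_le_subr1 2^-1; rewrite invr_gt0 ltr0n => /(_ isT).
  by rewrite lnV ?posrE//; lra.
have h : 2^-1 <= ln (n%:R : R).
  by apply: (le_trans l2); rewrite ler_ln ?posrE ?ltr0n ?ler_nat// ltnW.
have : ln 2^-1 <= ln (ln n%:R) :> R by rewrite ler_ln ?posrE ?invr_gt0 ?ln_nat_gt0.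
apply: le_trans; rewrite lnV ?posrE// lerN2.
by have := @ln_le_subr1 2; rewrite ltr0n => /(_ isT); lra.
Qed.

(* Since [ln 0 = 0], [ln (ln n)] drops from [0] to a negative value at [n = 2]. *)
Lemma lnln_nat_le_max (a b : nat) : (a <= b)%N ->
  ln (ln a%:R) <= Num.max 0 (ln (ln b%:R)) :> R.
Proof.
move=> ab; rewrite le_max; have [a1|a1] := leqP a 1; first by rewrite lnln_nat_le1// lexx.
apply/orP; right; have b1 := leq_trans a1 ab.
rewrite ler_ln ?posrE ?ln_nat_gt0// ler_ln ?posrE ?ler_nat//; rewrite ltr0n.
  exact: ltnW.
exact: ltnW.
Qed.

End LogLog.

(** * Growth rates *)

Section Entropy.
Context {R : realType} {disp : measure_display} {X : measurableType disp}.
Variables (d : X -> X -> R) (f : X -> X).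
Hypotheses (dM : is_metric d) (dK : dcompact d) (dB : borel_structure d).
Hypothesis (fC : dcontinuous d f).

Let span_growth (e : R) : \bar R := limn_esup
  (fun n : nat => ((n%:R)^-1 * ln (span_num d f n e)%:R)%R%:E).
Let NM_growth (e : R) : \bar R := limn_esup
  (fun n : nat => ((n%:R)^-1 * ln (ln (NM d f (Mper f) n e)%:R))%R%:E).

(** Quantization at scale [e / 2] shows that [NM] is an attained minimum, not the default [0]. *)
Lemma NM_cover n (e : R) : 0 < e -> exists L : seq (probability X R),
  size L = NM d f (Mper f) n e /\
  forall mu, Mper f mu -> exists2 nu, nu \in L & (W1n d f n mu nu <= e%:E)%E.
Proof.
move=> e0; apply: (@minnatP (fun k => exists L : seq (probability X R), size L = k /\
  forall mu, Mper f mu -> exists2 nu, nu \in L & (W1n d f n mu nu <= e%:E)%E)).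
have e20 : 0 < e / 2 by rewrite divr_gt0.
have [D D0 dD] := dn_bounded dM dK fC.
have [E HE] := finite_net dM dK fC n e20.
pose M := (Num.truncn ((size E)%:R * D / (e / 2))).+1.
have [||L [sL HL]] := NM_le dM dK dB fC (M := M) e20 _ (dD n) _ HE; first by [].
  by rewrite (mulrC (e / 2)) -ler_pdivrMr// ltW// truncnS_gt.
by exists (size L), L; split => // mu /HL; rewrite mulrCA divff// mulr1.
Qed.

Lemma NM_anti n (e1 e2 : R) : 0 < e1 -> e1 <= e2 ->
  (NM d f (Mper f) n e2 <= NM d f (Mper f) n e1)%N.
Proof.
move=> e10 e12; have [L [sL HL]] := NM_cover n e10.
apply: minnat_le; exists L; split => // mu /HL[nu nuL We]; exists nu => //.
by rewrite (le_trans We)// lee_fin.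
Qed.

Lemma NM_growth_ge0 (e : R) : (0 <= NM_growth e)%E.
Proof.
apply/lee_addgt0Pr => a a0; rewrite -leeBlDr// sub0e.
apply: limn_esup_ge => n0; exists (maxn n0 (Num.truncn a^-1).+1); first exact: leq_maxl.
set n := maxn _ _; rewrite -EFinN lee_fin.
have n0' : (0 < n)%N by rewrite /n; lia.
have nR : 0 < n%:R :> R by rewrite ltr0n.
have an : a^-1 <= n%:R.
  by apply: (le_trans (ltW (truncnS_gt _))); rewrite ler_nat leq_maxr.
rewrite mulrC ler_pdivlMr// (le_trans _ (lnln_nat_ge _))// mulNr lerN2.
by rewrite -ler_pdivrMl// mulr1.
Qed.

Lemma span_growth_ge0 (e : R) : (0 <= span_growth e)%E.
Proof.
apply: limn_esup_ge => n0; exists n0 => //.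
by rewrite lee_fin mulr_ge0 ?invr_ge0// ln_nat_ge0.
Qed.

Lemma NM_growth_anti (e1 e2 : R) : 0 < e1 -> e1 <= e2 -> (NM_growth e2 <= NM_growth e1)%E.
Proof.
move=> e10 e12; apply: limn_esup_le_max; first exact: NM_growth_ge0.
move=> n; rewrite -EFin_max lee_fin -[0](mulr0 n%:R^-1) -maxr_pMr ?invr_ge0//.
by rewrite ler_wpM2l ?invr_ge0//; apply: lnln_nat_le_max; exact: NM_anti.
Qed.

Lemma span_growth_anti (e1 e2 : R) : 0 < e1 -> e1 <= e2 -> (span_growth e2 <= span_growth e1)%E.
Proof.
move=> e10 e12; apply: limn_esup_le_max; first exact: span_growth_ge0.
move=> n; rewrite -EFin_max lee_fin le_max; apply/orP; right.
rewrite ler_wpM2l ?invr_ge0// ler_ln ?posrE ?ltr0n ?span_num_gt0// ?ler_nat.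
  exact: span_num_le.
exact: lt_le_trans e12.
Qed.

(** By monotonicity the [lim] in [htop] and [entM] is an actual limit, so both can be handled as
    suprema. *)
Lemma nonincreasing_lim_at_0 (F : R -> \bar R) :
  (forall e1 e2, 0 < e1 -> e1 <= e2 -> (F e2 <= F e1)%E) ->
  lim (F @ 0^'+) = ereal_sup [set F e | e in [set e : R | 0 < e]].
Proof.
move=> Fanti; apply: cvg_lim => //.
have -> : [set e : R | 0 < e] = [set` Interval (BRight (0 : R)) +oo%O].
  by apply/seteqP; split => x /=; rewrite in_itv/= andbT.
apply: nonincreasing_at_right_cvge => //.
by move=> x y; rewrite in_itv/= andbT => x0 _; exact: Fanti.
Qed.

(** With [S] the spanning number at [e / 2], [ln NMn] is at most [S * ln M.+1], and [ln M.+1] is at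
    most affine in [n]; its logarithm is negligible, so [S] alone sets the rate. *)
Lemma NM_growth_le_htop (e : R) : 0 < e -> (NM_growth e <= htop d f)%E.
Proof.
move=> e0; have htopE : htop d f = ereal_sup [set span_growth a | a in [set a : R | 0 < a]].
  exact: (nonincreasing_lim_at_0 span_growth_anti).
have e20 : 0 < e / 2 by rewrite divr_gt0.
have Hh : (span_growth (e / 2) <= htop d f)%E.
  by rewrite htopE; apply: ereal_sup_ubound; exists (e / 2).
have := le_trans (span_growth_ge0 (e / 2)) Hh.
case: (htop d f) Hh => [h||] Hh h0; [|by rewrite leey|by []].
rewrite lee_fin in h0; apply/lee_addgt0Pr => a a0.
pose c := h + a / 2; have c0 : 0 < c by rewrite /c ltr_wpDl// divr_gt0.
have [n1 Hn1] : exists n1, forall n, (n1 <= n)%N ->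
    (((n%:R)^-1 * ln (span_num d f n (e / 2))%:R)%:E < c%:E)%E.
  by apply: limn_esup_lt; rewrite (le_lt_trans Hh)// lte_fin /c ltrDl divr_gt0.
have [D D0 dD] := dn_bounded dM dK fC.
(* Chosen so that [M.+1 <= S * A]: the [2] covers the rounding in [M], as [1 <= S]. *)
pose A := D / (e / 2) + 2.
have A0 : 1 < A by rewrite /A; have := divr_gt0 D0 e20; lra.
have lA0 : 0 < ln A by exact: ln_gt0.
have [n2 Hn2] := @ln_affine_le R c (ln A) (a / 2) (ltW c0) lA0 (divr_gt0 a0 (ltr0n _ 2)).
apply: (@limn_esup_le _ _ _ (maxn (maxn n1 n2) 1)) => n.
rewrite !geq_max -andbA => /and3P[/Hn1 nc /Hn2 nA n0].
have nR : 0 < n%:R :> R by rewrite ltr0n.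
set NMn := NM _ _ _ _ _; set S := span_num _ _ _ _ in nc.
rewrite -EFinD lee_fin ler_pdivrMl//.
have [NM1|NM1] := leqP NMn 1.
  by rewrite lnln_nat_le1// mulr_ge0// addr_ge0// ltW.
have [E [sE HE]] := span_numP dM dK fC n e20.
have S0 : (0 < S)%N by exact: span_num_gt0.
have SR : 1 <= S%:R :> R by rewrite ler1n.
rewrite -/S in sE.
pose M := (Num.truncn (S%:R * D / (e / 2))).+1.
have [||L [sL HL]] := NM_le dM dK dB fC (M := M) e20 _ (dD n) _ HE; first by [].
  by rewrite sE (mulrC (e / 2)) -ler_pdivrMr// ltW// truncnS_gt.
have NMle : (NMn <= M.+1 ^ S)%N.
  apply: minnat_le; exists L; rewrite sL sE; split => // mu /HL.
  by rewrite mulrCA divff// mulr1.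
have MA : M.+1%:R <= S%:R * A.
  have : M.-1%:R <= S%:R * D / (e / 2).
    by rewrite /M/= truncn_le divr_ge0 ?mulr_ge0// ltW.
  by rewrite /A mulrDr mulrA /M -!natr1 /=; nra.
have lnM : ln M.+1%:R <= c * n%:R + ln A.
  apply: (@le_trans _ _ (ln (S%:R * A))).
    by rewrite ler_ln ?posrE ?mulr_gt0 ?ltr0n//; lra.
  rewrite lnM ?posrE ?ltr0n//; last lra.
  by rewrite lerD2r; move: nc; rewrite lte_fin ltr_pdivrMl// mulrC => /ltW.
have lnNM : ln NMn%:R <= S%:R * (c * n%:R + ln A).
  apply: (@le_trans _ _ (ln (M.+1 ^ S)%:R)).
    by rewrite ler_ln ?posrE ?ltr0n ?expn_gt0 ?ler_nat// ltnW.
  by rewrite natrX lnXn ?ltr0n// -[leLHS]mulr_natl ler_wpM2l.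
apply: (@le_trans _ _ (ln (S%:R * (c * n%:R + ln A)))).
  rewrite ler_ln ?posrE ?ln_nat_gt0// mulr_gt0 ?ltr0n//.
  by rewrite addr_gt0// mulr_gt0.
rewrite exp.lnM ?posrE ?ltr0n//; last by rewrite addr_gt0// mulr_gt0.
move: nc; rewrite lte_fin ltr_pdivrMl// => nc.
have -> : n%:R * (h + a) = n%:R * c + a / 2 * n%:R by rewrite /c; field.
by rewrite lerD// ltW.
Qed.

(** Take about [exp (m * c)] letters and words of length about [exp (n * c1)]. A letter carries
    information [m * c], while its window position costs about [n * c1]; since [c1 < c], at least
    [1] per letter is left, whence [ln NMn >= P1]. *)
Lemma NM_growth_lower (e c c1 : R) : pos_expansive d f -> specification d f ->
  0 < e -> 0 < c1 -> c1 < c -> (c%:E < span_growth e)%E ->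
  exists2 e1 : R, 0 < e1 & (c1%:E <= NM_growth e1)%E.
Proof.
move=> fE fS e0 c10 c1c cH.
have c0 : 0 < c by exact: lt_trans c1c.
pose s := e / 8; have s0 : 0 < s by rewrite divr_gt0.
have se : 8 * s = e by rewrite /s; field.
have [N [Q HNQ]] := periodic_specification dM dK fC fE fS s0.
pose theta := (c - c1) / (2 * c); pose alpha := (c + c1) / 2; pose g := (c - c1) / 2.
have theta0 : 0 < theta by rewrite divr_gt0 ?subr_gt0// mulr_gt0.
have alphaE : (1 - theta) * c = alpha by rewrite /theta /alpha; field; rewrite gt_eqF.
have alpha0 : 0 < alpha by rewrite /alpha; lra.
have g0 : 0 < g by rewrite /g; lra.
(* With [T <= 2 * P1 * n] this allows at most [theta * P1 / 4] bad windows, hence at most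
   [theta * P1] holes once [theta * P1 >= 2]. *)
pose e1 := theta * s / 32; have e10 : 0 < e1 by rewrite divr_gt0// mulr_gt0.
exists e1 => //; apply: limn_esup_ge => n0.
have [n1 Hn1] := @ln_affine_le R 6 1 (g / 4) (ler0n _ 6) ltr01 (divr_gt0 g0 (ltr0n _ 4)).
have [n2 Hn2] := @ln_affine_le R 0 (2 / theta) c1 (lexx 0) (divr_gt0 (ltr0n _ 2) theta0) c10.
pose n3 := (Num.truncn ((1 + alpha * N%:R) / (g / 2))).+1.
(* Beyond [n1], [ln (6 * n + 1)] is at most [g * n / 4]; beyond [n2], [theta * P1 >= 2]; beyond
   [n3], the gap [N] is absorbed; and [Q < m] bounds [T]. *)
have [m mn cm] := limn_esup_gt cH (maxn n0 (maxn n1 (maxn n2 (maxn n3 Q.+1)))).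
move: mn; rewrite !geq_max => /and5P[n0m n1m n2m n3m Qm].
pose n := (m + N)%N; have mn : (m <= n)%N by exact: leq_addr.
have m0 : (0 < m)%N by exact: leq_ltn_trans Qm.
have n_gt0 : (0 < n)%N by exact: leq_trans mn.
have nR : 0 < n%:R :> R by rewrite ltr0n.
have mR : 0 < m%:R :> R by rewrite ltr0n.
exists n; first exact: leq_trans mn.
have {cm}cm : expR (m%:R * c) < (span_num d f m e)%:R.
  rewrite -[ltRHS]lnK ?posrE ?ltr0n ?span_num_gt0// ltr_expR.
  by move: cm; rewrite lte_fin mulrC ltr_pdivlMr// mulrC.
pose K := Num.truncn (expR (m%:R * c)); pose P := Num.truncn (expR (n%:R * c1)).
pose P1 : R := P.+1%:R; pose K1 : R := K.+1%:R.
have Kspan : (K < span_num d f m e)%N.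
  by rewrite -(ltr_nat R) (le_lt_trans _ cm)// truncn_le expR_ge0.
have lnK1 : m%:R * c <= ln K1.
  rewrite -[leLHS]expRK ler_ln ?posrE ?expR_gt0 ?ltr0n//.
  by rewrite ltW// truncnS_gt.
have P1e : expR (n%:R * c1) <= P1 by rewrite ltW// truncnS_gt.
have exp1 : 1 <= expR (n%:R * c1) by rewrite -expR0 ler_expR mulr_ge0// ltW.
have P1e2 : P1 <= 2 * expR (n%:R * c1).
  rewrite /P1 -natr1; have : P%:R <= expR (n%:R * c1) by rewrite truncn_le expR_ge0.
  by lra.
have P10 : 0 < P1 by rewrite ltr0n.
have P1theta : 2 <= theta * P1.
  rewrite -ler_pdivrMl// mulrC (le_trans _ P1e)//.
  have pos2 : 2 / theta \is Num.pos by rewrite posrE divr_gt0.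
  rewrite -(lnK pos2) ler_expR (mulrC n%:R).
  by have := Hn2 n (leq_trans n2m mn); rewrite mul0r add0r.
pose T := (P.+1 * n + Q)%N; pose B := Num.truncn (theta * P1).
have TR : T%:R <= 2 * P1 * n%:R.
  have : Q%:R <= P1 * n%:R.
    by rewrite -natrM ler_nat (leq_trans (ltnW Qm))// (leq_trans mn)// leq_pmull.
  by rewrite /T natrD natrM -/P1; lra.
have holesB (k : nat) : s * (k * n)%:R <= 4 * e1 * T%:R -> ((2 * k).+1 <= B)%N.
  move=> Hk; have e1E : 4 * e1 = theta * s / 8 by rewrite /e1; field.
  have : s * (k%:R * n%:R) <= theta * s / 8 * (2 * P1 * n%:R).
    rewrite -natrM (le_trans Hk)// e1E ler_wpM2l//.
    by rewrite divr_ge0// mulr_ge0// ltW.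
  have -> : s * (k%:R * n%:R) = s * n%:R * k%:R by ring.
  have -> : theta * s / 8 * (2 * P1 * n%:R) = s * n%:R * (theta * P1 / 4) by field.
  rewrite ler_pM2l ?mulr_gt0// => k4.
  by rewrite truncn_gt_nat -natr1 natrM; lra.
have [L [sL HL]] := NM_cover n e10.
have := @words_le_cover R disp X d f dM dK dB fC e e1 s N Q m P K B e0 se e10 n_gt0
  (HNQ m P.+1) Kspan holesB L HL.
rewrite sL -/n -/T; set NMn := NM _ _ _ _ _ => count.
have NM0 : (0 < NMn)%N.
  by move: count; case: NMn => //; rewrite mul0n leqn0 expn_eq0.
have K10 : 0 < K1 by rewrite ltr0n.
have lncount : P1 * ln K1 <= ln NMn%:R + (ln n%:R + P1 * ln T.+1%:R + B%:R * ln K1).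
  have := count; rewrite -(ler_nat R) natrX !natrM !natrX => {}count.
  rewrite /P1 mulr_natl -lnXn// mulr_natl -lnXn ?ltr0n// mulr_natl -lnXn//.
  rewrite -!lnM ?posrE ?mulr_gt0 ?exprn_gt0 ?ltr0n//.
  by rewrite ler_ln ?posrE ?mulr_gt0 ?exprn_gt0 ?ltr0n.
have BR : B%:R <= theta * P1 by rewrite truncn_le mulr_ge0// ltW.
have lnT : ln T.+1%:R <= n%:R * c1 + ln (6 * n%:R + 1).
  have T1 : T.+1%:R <= expR (n%:R * c1) * (6 * n%:R + 1).
    have : 2 * P1 * n%:R <= 4 * expR (n%:R * c1) * n%:R by rewrite ler_wpM2r//; lra.
    have : 0 <= expR (n%:R * c1) * n%:R by rewrite mulr_ge0// expR_ge0.
    by rewrite -natr1 mulrDr mulr1; lra.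
  rewrite (le_trans (_ : _ <= ln (expR (n%:R * c1) * (6 * n%:R + 1))))//.
    by rewrite ler_ln ?posrE ?mulr_gt0 ?expR_gt0 ?ltr0n//; lra.
  by rewrite lnM ?posrE ?expR_gt0 ?expRK//; lra.
have ln6 := Hn1 n (leq_trans n1m mn).
have lnn : ln n%:R <= ln (6 * n%:R + 1) :> R.
  by rewrite ler_ln ?posrE//; lra.
have n3R : 1 + alpha * N%:R <= g / 2 * n%:R.
  rewrite (mulrC (g / 2)) -ler_pdivrMr ?(divr_gt0 g0)//; apply: (le_trans (ltW (truncnS_gt _))).
  by rewrite ler_nat (leq_trans n3m).
have lnNM : P1 <= ln NMn%:R.
  have lK0 : 0 <= ln K1 by rewrite ln_ge0// ler1n.
  have h1 : P1 * alpha * m%:R <= (P1 - B%:R) * ln K1.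
    rewrite -alphaE; apply: (@le_trans _ _ ((1 - theta) * P1 * ln K1)); last first.
      by rewrite ler_wpM2r//; lra.
    have -> : P1 * ((1 - theta) * c) * m%:R = (1 - theta) * P1 * (m%:R * c) by ring.
    rewrite ler_wpM2l// mulr_ge0// ?(ltW P10)//.
    by rewrite -(pmulr_lge0 _ c0) alphaE ltW.
  have nE : n%:R = m%:R + N%:R :> R by rewrite /n natrD.
  have gE : g = alpha - c1 by rewrite /g /alpha; field.
  (* Here [alpha * m - n * c1 = g * n - alpha * N]: half of [g * n] pays for the logarithms, the
     other half for [1 + alpha * N]. *)
  have br : 1 <= alpha * m%:R - n%:R * c1 - 2 * ln (6 * n%:R + 1).
    by move: n3R ln6; rewrite gE nE; lra.
  have P11 : 1 <= P1 by rewrite ler1n.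
  have h2 : P1 * 1 <= P1 * (alpha * m%:R - n%:R * c1 - 2 * ln (6 * n%:R + 1)).
    by rewrite ler_wpM2l// ltW.
  have h3 : P1 * ln T.+1%:R <= P1 * (n%:R * c1 + ln (6 * n%:R + 1)).
    by rewrite ler_wpM2l// ltW.
  have h4 : ln n%:R <= P1 * ln (6 * n%:R + 1).
    rewrite (le_trans lnn)// ler_peMl//; exact: le_trans (ln_nat_ge0 _) lnn.
  by lra.
rewrite lee_fin mulrC ler_pdivlMr// mulrC.
rewrite -[leLHS]expRK ler_ln ?posrE ?expR_gt0//; first exact: le_trans lnNM.
exact: lt_le_trans lnNM.
Qed.

Lemma htop_le_entM : pos_expansive d f -> specification d f ->
  (htop d f <= entM d f (Mper f))%E.
Proof.
move=> fE fS; rewrite /htop /entM (nonincreasing_lim_at_0 NM_growth_anti).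
rewrite (nonincreasing_lim_at_0 span_growth_anti).
apply: ge_ereal_sup => _ [e /= e0 <-].
set S := ereal_sup [set NM_growth e | e in _].
have G0 : (0 <= S)%E.
  apply: le_trans (NM_growth_ge0 1) _; apply: ereal_sup_ubound; exists 1 => //=; exact: ltr01.
rewrite leNgt; apply/negP => GH.
have [g gE] : exists g : R, S = g%:E.
  move: G0 GH; case: (S) => [g _ _|_|//]; first by exists g.
  by rewrite ltNge leey.
rewrite gE in G0 GH; rewrite lee_fin in G0.
(* Two reals fit between the supremum [g] and the span growth, [c] and the midpoint of [g] and [c];
   the midpoint would be a lower bound for some [NM_growth]. *)
have [c gc cH] : exists2 c, g < c & (c%:E < span_growth e)%E.
  move: GH; case: (span_growth e) => [h|_|//]; last by exists (g + 1); [lra|rewrite ltry].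
  by rewrite lte_fin => gh; exists ((g + h) / 2); rewrite ?lte_fin; lra.
have [||e1 e10 ge1] := @NM_growth_lower e c ((g + c) / 2) fE fS e0 _ _ cH; try lra.
have : (((g + c) / 2)%:E <= g%:E)%E.
  by rewrite -gE (le_trans ge1)//; apply: ereal_sup_ubound; exists e1.
by rewrite lee_fin; lra.
Qed.

Lemma entM_le_htop : (entM d f (Mper f) <= htop d f)%E.
Proof.
rewrite /entM (nonincreasing_lim_at_0 NM_growth_anti); apply: ge_ereal_sup => _ [e /= e0 <-].
exact: NM_growth_le_htop.
Qed.

End Entropy.

Theorem theorem1p4 (R : realType) (disp : measure_display)
  (X : measurableType disp) (d : X -> X -> R) (f : X -> X) :
  is_metric d -> dcompact d -> borel_structure d ->
  dcontinuous d f -> pos_expansive d f -> specification d f ->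
  htop d f = entM d f (Mper f).
Proof.
move=> dM dK dB fC fE fS; apply/eqP.
by rewrite eq_le htop_le_entM// entM_le_htop.
Qed.
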